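(* Let $n\ge1$, let $\theta$ be a real skew-symmetric $n\times n$ matrix, let $1\le p\le\infty$ and $d\ge 1$, and let $x$ be a holomorphic polynomial in the quantum torus $\mathbb{T}_\theta$. \begin{enumerate} \item If $x\in\mathcal{P}^{\ge d}$, then $\|P^\theta_t(x)\|_p\le e^{-td}\|x\|_p$ for all $t\ge0$, and $\|L_\theta(x)\|_p\ge d\|x\|_p$. \item If $x\in\mathcal{P}^{\le d}$, then $\|L_\theta(x)\|_p\le d\|x\|_p$, and $\|P^\theta_t(x)\|_p\ge e^{-td}\|x\|_p$ for all $t\ge0$. \end{enumerate}
   Context: $\mathcal{A}_\theta$ is the universal $C^*$-algebra generated by unitaries $U_1,\dots,U_n$ with $U_jU_k=e^{2\pi i\theta_{jk}}U_kU_j$. For $\alpha\in\mathbb{Z}^n$, $U^\alpha=U_1^{\alpha_1}\cdots U_n^{\alpha_n}$; polynomials are finite sums $\sum_\alpha x_\alpha U^\alpha$, $x_\alpha\in\mathbb{C}$. The functional $\tau_\theta(\sum_\alpha x_\alpha U^\alpha)=x_0$ extends to a faithful tracial state, and $\mathbb{T}_\theta$ is the von Neumann algebra obtained by the GNS construction of $(\mathcal{A}_\theta,\tau_\theta)$. Norms: $\|x\|_p=\tau_\theta((x^*x)^{p/2})^{1/p}$ for $1\le p<\infty$, operator norm for $p=\infty$. With $|\alpha|=\sum_j|\alpha_j|$, $P^\theta_t(\sum_\alpha x_\alpha U^\alpha)=\sum_\alpha e^{-t|\alpha|}x_\alpha U^\alpha$ and $L_\theta(\sum_\alpha x_\alpha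 U^\alpha)=\sum_\alpha|\alpha|x_\alpha U^\alpha$, so $P^\theta_t=e^{-tL_\theta}$. $\mathcal{P}^{\le d}$ (resp. $\mathcal{P}^{\ge d}$) is the complex span of $\{U^\alpha:|\alpha|\le d\}$ (resp. $\{U^\alpha:|\alpha|\ge d\}$). A polynomial is holomorphic if it has the form $\sum_{\alpha\in\mathbb{N}^n}x_\alpha U^\alpha$ (finite sum, all $\alpha_j\ge0$). *)

(* Defs.v *)
From HB Require Import structures.
From mathcomp Require Import all_boot all_order all_algebra.
From mathcomp Require Import all_classical all_reals all_analysis.
From mathcomp Require Import complex.
Set Implicit Arguments. Unset Strict Implicit. Unset Printing Implicit Defensive.
Import Order.TTheory GRing.Theory Num.Theory.
Local Open Scope ring_scope.
Local Open Scope classical_set_scope.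

(* Multi-indices alpha in Z^n are row vectors 'rV[int]_n.                    *)
(* |alpha| = sum_j |alpha_j|.                                                *)
Definition mdeg (n : nat) (a : 'rV[int]_n) : nat := (\sum_(j < n) `|a ord0 j|)%N.

Section QTorus.
Variable R : realType.
Local Notation C := R[i].

(* e^{i phi} *)
Definition cexpi (phi : R) : C := Complex (cos phi) (sin phi).

(* Structure constants of A_theta: with U^a = U_1^{a_1} ... U_n^{a_n} and
   U_j U_k = e^{2 pi i theta_jk} U_k U_j one has
   U^a U^b = phase theta a b * U^{a+b},
   phase theta a b = exp(2 pi i sum_{j<k} theta_kj a_k b_j).                 *)
Definition phase (n : nat) (theta : 'M[R]_n) (a b : 'rV[int]_n) : C :=
  cexpi (2 * pi * \sum_(j < n) \sum_(k < n | (j < k)%N)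
           theta k j * (a ord0 k)%:~R * (b ord0 j)%:~R).

(* A polynomial sum_alpha x_alpha U^alpha is represented by a finite list of
   terms (alpha, c), standing for the sum of the c U^alpha.                  *)
Definition tpoly (n : nat) := seq ('rV[int]_n * C).

(* The coefficient x_alpha. *)
Definition coef (n : nat) (x : tpoly n) (a : 'rV[int]_n) : C :=
  \sum_(t <- x | t.1 == a) t.2.

(* Product in A_theta. *)
Definition tmul (n : nat) (theta : 'M[R]_n) (x y : tpoly n) : tpoly n :=
  [seq (t.1 + s.1, phase theta t.1 s.1 * t.2 * s.2) | t <- x, s <- y].

(* Unit U^0. *)
Definition tone (n : nat) : tpoly n := [:: (0, 1)].

Definition texp (n : nat) (theta : 'M[R]_n) (x : tpoly n) (k : nat) : tpoly n :=
  iter k (tmul theta x) (tone n).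

(* Involution: (c U^a)^* = conj c (U^a)^{-1}, and since
   U^a U^{-a} = phase a (-a) * 1 with |phase| = 1,
   (U^a)^{-1} = conj (phase a (-a)) U^{-a}.                                  *)
Definition tadj (n : nat) (theta : 'M[R]_n) (x : tpoly n) : tpoly n :=
  [seq (- t.1, (t.2)^* * (phase theta t.1 (- t.1))^*)%C | t <- x].

(* The trace tau_theta. *)
Definition ttau (n : nat) (x : tpoly n) : C := coef x 0.

(* Real moments tau((x^* x)^k). *)
Definition moment (n : nat) (theta : 'M[R]_n) (x : tpoly n) (k : nat) : R :=
  complex.Re (ttau (texp theta (tmul theta (tadj theta x) x) k)).

(* ||x||_infty: operator norm of the GNS (left regular) representation of x
   on L^2(A_theta, tau_theta); finitely supported vectors xi are dense, and
   ||xi||_2^2 = tau(xi^* xi).                                                *)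
Definition opnorm (n : nat) (theta : 'M[R]_n) (x : tpoly n) : R :=
  sup [set r : R | exists xi : tpoly n,
         complex.Re (ttau (tmul theta (tadj theta xi) xi)) <= 1 /\
         r = Num.sqrt (complex.Re (ttau (tmul theta (tadj theta (tmul theta x xi))
                                                       (tmul theta x xi))))].

(* Spectral distribution of the positive element x^* x w.r.t. tau_theta:
   a compactly supported probability measure on [0, +oo) whose moments are
   tau((x^* x)^k); it is unique, and tau(f(x^* x)) = int f dmu for every
   continuous f (Borel functional calculus).                                 *)
Definition spec_dist (n : nat) (theta : 'M[R]_n) (x : tpoly n)
    (mu : probability R R) : Prop :=
  exists M : R, let I := [set s : R | 0 <= s <= M] in
    mu (~` I) = 0%E /\
    forall k : nat, (\int[mu]_(s in I) (s ^+ k)%:E)%E = (moment theta x k)%:E.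

(* ||x||_p = tau(|x|^p)^{1/p} = (int s^{p/2} dmu(s))^{1/p}, 1 <= p < oo. *)
Definition is_Lpnorm (n : nat) (theta : 'M[R]_n) (p : R) (x : tpoly n) (r : R) : Prop :=
  exists mu : probability R R, spec_dist theta x mu /\
    let J := [set s : R | 0 <= s] in
    r = (fine (\int[mu]_(s in J) (s `^ (p / 2))%:E)%E) `^ p^-1.

Definition Lpnorm (n : nat) (theta : 'M[R]_n) (p : R) (x : tpoly n) : R :=
  xget 0 (is_Lpnorm theta p x).

(* ||x||_p for p in [1, +oo]. *)
Definition qnorm (n : nat) (theta : 'M[R]_n) (p : \bar R) (x : tpoly n) : R :=
  match p with
  | EFin q => Lpnorm theta q x
  | +oo%E => opnorm theta x
  | -oo%E => 0
  end.

(* Poisson semigroup P_t and generator L_theta. *)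
Definition Pt (n : nat) (t : R) (x : tpoly n) : tpoly n :=
  [seq (s.1, (expR (- t * (mdeg s.1)%:R))%:C * s.2)%C | s <- x].

Definition Lgen (n : nat) (x : tpoly n) : tpoly n :=
  [seq (s.1, ((mdeg s.1)%:R : R)%:C * s.2)%C | s <- x].

(* holomorphic: only multi-indices in N^n carry nonzero coefficients *)
Definition holomorphic (n : nat) (x : tpoly n) : Prop :=
  forall a, coef x a != 0 -> forall j, 0 <= a ord0 j.

(* x in P^{>= d} / P^{<= d} *)
Definition in_Pge (n : nat) (d : nat) (x : tpoly n) : Prop :=
  forall a, coef x a != 0 -> (d <= mdeg a)%N.
Definition in_Ple (n : nat) (d : nat) (x : tpoly n) : Prop :=
  forall a, coef x a != 0 -> (mdeg a <= d)%N.

End QTorus.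

(* Main.v *)
Require Import Defs.
From HB Require Import structures.
From mathcomp Require Import all_boot all_order all_algebra all_solvable all_field.
From mathcomp Require Import all_classical all_reals all_analysis.
From mathcomp Require Import measurable_realfun uniform_distribution random_variable.
From mathcomp Require Import complex spectral sesquilinear.
From mathcomp Require Import ring lra zify.
Set Implicit Arguments. Unset Strict Implicit. Unset Printing Implicit Defensive.
Import Order.TTheory GRing.Theory Num.Theory.
Import numFieldNormedType.Exports.
Local Open Scope ring_scope.

(* On holomorphic polynomials |a| = a_1 + ... + a_n, so the multipliers
   |a| |-> z^|a| with |z| = 1 are trace preserving automorphisms, hence isometric
   for every norm.  In each of the four inequalities the multiplier that is to be
   bounded has the form k |-> a_|k-d| with k on one side of d and a convex,
   nonincreasing and nonnegative: e^{-tj}, 1/(d+j) or (d-j)_+.  Such a sequence is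
   a nonnegative combination of Fejer kernels, so the multiplier is a combination
   of automorphisms z^|a| with coefficients of total mass a_0.

   For p = oo one concludes with the triangle inequality.  For p < oo let X_M be
   the compression of x to the box {0,..,M}^n of Z^n.  As Z^n is amenable, the
   normalized traces of (X_M^* X_M)^k converge to tau((x^* x)^k); hence the
   empirical distributions of the squared singular values of X_M converge to the
   spectral distribution of x^* x (which is obtained as a limit of quantile
   functions along an ultrafilter), and ||x||_p is the limit of the normalized
   Schatten norms of X_M.  The automorphisms act on X_M as conjugation by diagonal
   unitaries, and Peierls' inequality gives the bound for each M. *)

(** * Multipliers given by convex sequences *)

Section Multipliers.
Variable R : realType.
Local Notation C := R[i].
Local Notation "x %:C" := (real_complex R x) (format "x %:C").

(** The two lower bounds are upper bounds in disguise: multiplication by [1/k] or [e^{tk}] in degree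
    [k] recovers [x] from [Lgen x] or [Pt t x], which have no degrees that [x] does not have.
    Written around [d], these multipliers are [1/(d+j)] with [k = d+j] and [e^{td} e^{-tj}] with
    [k = d-j]. The mass [a_0] is the value of the multiplier at [k = d], and that is exactly the
    constant claimed. Values on the other side of [d] are free since no such degree occurs, which
    allows the symmetric extension that positivity requires. As [x] has finitely many coefficients,
    agreement for finitely many [k] is enough, so finite sums replace measures on the circle.

    For finite [p] the norm is read off some measure with prescribed moments, so existence of such a
    measure and independence of its choice both have to come from the moments; the truncations serve
    both purposes. The triangle inequality for finite [p] is proved only for matrices, where it
    reduces to scalar convexity. *)

Lemma prim_root_exists (N : nat) : (0 < N)%N ->
  exists z : C, N.-primitive_root z.
Proof.
move=> N_gt0; pose p : {poly C} := 'X^N - 1.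
have [r Dp] := closed_field_poly_normal p.
move: Dp; rewrite (monicP _) ?monicXnsubC // scale1r => Dp.
have rn1 : all N.-unity_root r.
  by apply/allP=> z; rewrite -root_prod_XsubC -Dp.
have sz_r : (N < (size r).+1)%N.
  by rewrite -(size_prod_XsubC r id) -Dp size_XnsubC.
have : has N.-primitive_root r.
  apply: has_prim_root => //; rewrite -separable_prod_XsubC -Dp.
  by rewrite separable_Xn_sub_1 // pnatr_eq0 -lt0n.
by case/hasP=> z _ zP; exists z.
Qed.

Lemma norm_unity_root (N : nat) (z : C) : (0 < N)%N -> z ^+ N = 1 -> `|z| = 1.
Proof.
move=> N0 zN; apply/eqP; rewrite -(@pexpr_eq1 _ _ N) // -?normrX ?zN ?normr1 //.
Qed.

Lemma sum_prim_root (N r : nat) (z : C) : N.-primitive_root z -> (0 < N)%N ->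
  \sum_(i < N) (z ^+ r) ^+ i = if (N %| r)%N then N%:R else 0.
Proof.
move=> zP N0; case: ifPn => [|Nr].
  rewrite (prim_order_dvd zP) => /eqP ->.
  by under eq_bigr do rewrite expr1n; rewrite sumr_const card_ord.
have zr1 : z ^+ r - 1 != 0 by rewrite subr_eq0 -(prim_order_dvd zP).
apply: (mulfI zr1); rewrite -subrX1 -exprM mulnC exprM (prim_expr_order zP).
by rewrite expr1n subrr mulr0.
Qed.

(** On [[0, K]], [a] is the Fourier transform of a positive measure on the unit circle with finitely
    many atoms: pairs (mass, point). *)
Definition posdef_on (K : nat) (a : nat -> R) : Prop :=
  exists s : seq (R * C), (forall t, t \in s -> 0 <= t.1 /\ `|t.2| = 1) /\
    forall j, (j <= K)%N -> (a j)%:C = \sum_(t <- s) t.1%:C * t.2 ^+ j.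

Lemma posdef_on_const K (c : R) : 0 <= c -> posdef_on K (fun=> c).
Proof.
move=> c0; exists [:: (c, 1)]; split=> [t|j _].
  by rewrite inE => /eqP -> /=; rewrite normr1.
by rewrite big_seq1 expr1n mulr1.
Qed.

Lemma posdef_onD K a b : posdef_on K a -> posdef_on K b ->
  posdef_on K (fun j => a j + b j).
Proof.
move=> [s [s0 sE]] [u [u0 uE]]; exists (s ++ u); split=> [t|j jK].
  by rewrite mem_cat => /orP[/s0|/u0].
by rewrite big_cat /= -sE // -uE // rmorphD.
Qed.

Lemma posdef_onZ K (c : R) a : 0 <= c -> posdef_on K a ->
  posdef_on K (fun j => c * a j).
Proof.
move=> c0 [s [s0 sE]]; exists [seq (c * t.1, t.2) | t <- s]; split=> [t|j jK].
  by case/mapP => u /s0 [u1 u2] -> /=; rewrite mulr_ge0.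
rewrite big_map rmorphM /= sE // mulr_sumr.
by apply: eq_bigr => t _; rewrite rmorphM mulrA.
Qed.

Lemma posdef_on_ext K a b : (forall j, (j <= K)%N -> a j = b j) ->
  posdef_on K a -> posdef_on K b.
Proof.
by move=> ab [s [s0 sE]]; exists s; split=> // j jK; rewrite -ab // sE.
Qed.

(* The Fejer kernel: [m - j] counts the pairs [(l, l + j)] in [0, m)^2, and
   averaging [`|\sum_(l < m) z ^ l|^2 z ^ j] over the roots of unity of a large
   order counts the same pairs. *)
Lemma posdef_on_fejer K m : posdef_on K (fun j => (m - j)%:R).
Proof.
(* With this order [l + j - l'] lies strictly between [-N] and [N], so divisibility by [N] forces
   [l' = l + j]. *)
pose N := (m + K).+1; have N0 : (0 < N)%N by [].
have [z zP] := prim_root_exists N0.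
have z1 : `|z| = 1 by apply: (norm_unity_root N0); exact: prim_expr_order zP.
pose W (i : nat) : C := \sum_(l < m) (z ^+ i) ^+ l.
pose w (i : nat) : R := N%:R^-1 * complex.Re (`|W i| ^+ 2).
have wE i : (w i)%:C = N%:R^-1 * `|W i| ^+ 2.
  have r0 : `|W i| ^+ 2 \is Num.real by rewrite ger0_real // exprn_ge0.
  have := RRe_real r0; rewrite /w => {2}<-.
  by rewrite /= rmorphM /= fmorphV /= rmorph_nat.
have zi i : `|z ^+ i| = 1 by rewrite normrX z1 expr1n.
exists [seq (w i, z ^+ i) | i <- iota 0 N]; split=> [t|j jK].
  case/mapP => i _ -> /=; split; last exact: zi.
  by rewrite -(ler0c) wE mulr_ge0 ?invr_ge0 ?ler0n ?exprn_ge0.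
rewrite big_map -[iota 0 N]/(index_iota 0 N) big_mkord /=.
transitivity (N%:R^-1 * \sum_(i < N) \sum_(l < m) \sum_(l' < m)
    (z ^+ (l + j + (N - l'))) ^+ i : C); last first.
  rewrite mulr_sumr; apply: eq_bigr => i _; rewrite wE -mulrA; congr (_ * _).
  have zu : z \is a GRing.unit by rewrite unitfE -normr_eq0 z1 oner_neq0.
  rewrite normCK /W rmorph_sum /= mulrAC mulr_suml mulr_suml.
  apply: eq_bigr => l _; rewrite mulr_sumr; apply: eq_bigr => l' _.
  have -> : ((z ^+ i) ^+ l')^* = ((z ^+ i) ^+ l')^-1.
    by rewrite invC_norm normrX zi !expr1n invr1 mul1r.
  have l'N : (l' <= N)%N by have := ltn_ord l'; rewrite /N; lia.
  have iN : (z ^+ i) ^+ N = 1.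
    by rewrite -exprM mulnC exprM (prim_expr_order zP) expr1n.
  rewrite -exprM [(_ * i)%N]mulnC exprM !exprD exprB ?unitrX // iN mul1r.
  by rewrite mulrAC.
rewrite exchange_big /=; under eq_bigr do rewrite exchange_big /=.
under eq_bigr => l _ do under eq_bigr => l' _ do rewrite (sum_prim_root _ zP N0).
transitivity (N%:R^-1 * \sum_(l < m) \sum_(l' < m)
   (if (l' == l + j :> nat)%N then N%:R else 0) : C); last first.
  congr (_ * _); apply: eq_bigr => l _; apply: eq_bigr => l' _.
  have lN := ltn_ord l; have l'N := ltn_ord l'.
  congr (if _ then _ else _); apply/idP/idP => [/eqP ->|].
    by rewrite subnKC // /N; lia.
  case/dvdnP => k; rewrite /N => kE; apply/eqP; case: k kE => [|[|k]]; nia.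
transitivity (N%:R^-1 * \sum_(l < m | (l < m - j)%N) N%:R : C).
  rewrite -(big_ord_widen _ (fun=> N%:R)) ?leq_subr // sumr_const card_ord.
  rewrite rmorph_nat -[N%:R *+ _]mulr_natr mulrA mulVf ?mul1r //.
  by rewrite pnatr_eq0.
congr (_ * _); rewrite big_mkcond; apply: eq_bigr => l _; case: ifPn => lm.
  have l'm : (l + j < m)%N by lia.
  rewrite (bigD1 (Ordinal l'm)) //= eqxx big1 ?addr0 // => l' /eqP l'P.
  by case: eqP => // l'E; case: l'P; apply: val_inj.
rewrite big1 // => l' _; case: eqP => // l'E; have := ltn_ord l'; lia.
Qed.

Lemma posdef_on_sum K m (F : nat -> nat -> R) :
  (forall l, posdef_on K (F l)) -> posdef_on K (fun j => \sum_(l < m) F l j).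
Proof.
move=> FP; elim: m => [|m IHm].
  by apply: posdef_on_ext (posdef_on_const K (lexx 0)) => j _; rewrite big_ord0.
by apply: posdef_on_ext (posdef_onD IHm (FP m)) => j _; rewrite big_ord_recr.
Qed.

(* Abel summation twice writes a convex sequence as a nonnegative combination of
   Fejer kernels. *)
Lemma convex_fejerE (a : nat -> R) K j : (j <= K)%N ->
  a j = a K + (a K - a K.+1) * (K - j)%:R +
    \sum_(l < K) (a l - 2 * a l.+1 + a l.+2) * (l.+1 - j)%:R.
Proof.
elim: K => [|K IHK]; first by rewrite leqn0 => /eqP ->; rewrite big_ord0 subnn mulr0 !addr0.
rewrite leq_eqVlt => /orP[/eqP ->|jK].
  rewrite subnn big1 ?mulr0 ?addr0 // => l _.
  by rewrite (_ : _ - _ = 0)%N ?mulr0 //; have := ltn_ord l; lia.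
rewrite [LHS]IHK // big_ord_recr /= subSn //.
move: (\sum_(l < K) _) => S; rewrite -natr1; ring.
Qed.

Lemma posdef_on_convex K (a : nat -> R) : (forall j, 0 <= a j) ->
  (forall j, a j.+1 <= a j) ->
  (forall j, 2 * a j.+1 <= a j + a j.+2) -> posdef_on K a.
Proof.
move=> a0 a_dec a_cvx.
refine (posdef_on_ext (fun j jK => esym (convex_fejerE a jK)) _).
have aK0 : 0 <= a K - a K.+1 by rewrite subr_ge0.
have cvx l : 0 <= a l - 2 * a l.+1 + a l.+2 by have := a_cvx l; lra.
exact: (posdef_onD (posdef_onD (posdef_on_const _ (a0 K))
  (posdef_onZ aK0 (posdef_on_fejer _ K)))
  (posdef_on_sum _ (fun l => posdef_onZ (cvx l) (posdef_on_fejer _ l.+1)))).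
Qed.

(** [P] selects the degrees that occur, and [c] is the total variation of a complex discrete measure
    on the circle; it becomes the norm bound of the multiplier [m]. *)
Definition circle_moments (P : pred nat) (m : nat -> R) (c : R) : Prop :=
  exists s : seq (C * C), [/\ forall t, t \in s -> `|t.2| = 1,
    \sum_(t <- s) `|t.1| = c%:C &
    forall k, P k -> (m k)%:C = \sum_(t <- s) t.1 * t.2 ^+ k].

Lemma posdef_on_mass K a (s : seq (R * C)) :
  (forall t, t \in s -> 0 <= t.1 /\ `|t.2| = 1) ->
  (forall j, (j <= K)%N -> (a j)%:C = \sum_(t <- s) t.1%:C * t.2 ^+ j) ->
  \sum_(t <- s) `|t.1%:C| = (a 0%N)%:C.
Proof.
move=> s0 sE; rewrite sE // big_seq [RHS]big_seq; apply: eq_bigr => t ts.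
by rewrite expr0 mulr1 ger0_norm // ler0c; case: (s0 _ ts).
Qed.

Lemma unit_exprB (z : C) k j : `|z| = 1 -> (k <= j)%N ->
  z ^+ (j - k) = z ^+ j * z ^- k.
Proof.
move=> z1 kj; rewrite exprB // unitfE -normr_eq0 z1.
exact: oner_neq0.
Qed.

(** Shifting the degree by [d] multiplies each weight by [z^{-d}], of modulus one, so the mass
    remains [a 0]. *)
Lemma circle_moments_ge K d a : posdef_on K a ->
  circle_moments (fun k => d <= k <= K)%N (fun k => a (k - d)%N) (a 0%N).
Proof.
case=> s [s0 sE]; exists [seq (t.1%:C * t.2 ^- d, t.2) | t <- s]; split.
- by move=> t /mapP[u /s0[_ u1] ->].
- rewrite big_map -(posdef_on_mass s0 sE) big_seq [RHS]big_seq.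
  apply: eq_bigr => t /s0[_ t1].
  by rewrite normrM normrV ?normrX ?t1 ?expr1n ?invr1 ?mulr1 // unitfE expf_neq0 // -normr_eq0 t1 oner_neq0.
- move=> k /andP[dk kK]; rewrite big_map sE ?(leq_trans (leq_subr _ _)) //.
  rewrite big_seq [RHS]big_seq; apply: eq_bigr => t /s0[_ t1].
  by rewrite (unit_exprB t1 dk) mulrAC mulrA.
Qed.

(** Here the degree is also reversed: each atom moves from [z] to [z^{-1}] and its weight is
    multiplied by [z^d]. *)
Lemma circle_moments_le d a : posdef_on d a ->
  circle_moments (fun k => k <= d)%N (fun k => a (d - k)%N) (a 0%N).
Proof.
case=> s [s0 sE]; exists [seq (t.1%:C * t.2 ^+ d, t.2^-1) | t <- s]; split.
- by move=> t /mapP[u /s0[_ u1] ->] /=; rewrite normfV u1 invr1.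
- rewrite big_map -(posdef_on_mass s0 sE) big_seq [RHS]big_seq.
  apply: eq_bigr => t /s0[_ t1].
  by rewrite normrM normrX t1 expr1n mulr1.
- move=> k kd; rewrite big_map sE ?leq_subr //.
  rewrite big_seq [RHS]big_seq; apply: eq_bigr => t /s0[_ t1].
  by rewrite (unit_exprB t1 kd) mulrA exprVn.
Qed.
End Multipliers.

(** * Jensen's inequality and hermitian dilations *)

Section Jensen.
Variable R : realType.

Lemma powR_jensen (I : Type) (r : seq I) (w v : I -> R) (p : R) : 1 <= p ->
  (forall i, 0 <= w i) -> (forall i, 0 <= v i) -> \sum_(i <- r) w i = 1 ->
  (\sum_(i <- r) w i * v i) `^ p <= \sum_(i <- r) w i * v i `^ p.
Proof.
move=> p1 w0 v0 w1.
(* Removing an element destroys the total weight 1, so the induction runs on normalized means with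
   any positive total weight. *)
suff H : 0 < \sum_(i <- r) w i ->
    ((\sum_(i <- r) w i * v i) / \sum_(i <- r) w i) `^ p <=
    (\sum_(i <- r) w i * v i `^ p) / \sum_(i <- r) w i.
  by move: H; rewrite w1 !divr1; apply; exact: ltr01.
elim: r {w1} => [|i r IHr]; first by rewrite !big_nil ltxx.
rewrite !big_cons; set W := \sum_(j <- r) w j; set S := \sum_(j <- r) w j * v j.
set T := \sum_(j <- r) w j * v j `^ p => W'0.
have W_ge0 : 0 <= W by exact: sumr_ge0.
have S_ge0 : 0 <= S by apply: sumr_ge0 => j _; rewrite mulr_ge0.
(* A tail of weight zero has no mean ([S / W] would be a division by zero); then only the head
   counts. *)
have [W0|WN0] := eqVneq W 0.
  have wj0 (g : I -> R) : \sum_(j <- r) w j * g j = 0.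
    move: W0; rewrite /W; elim: (r) => [|j l IHl]; rewrite ?big_nil // !big_cons.
    move=> /eqP; rewrite paddr_eq0 ?sumr_ge0 // => /andP[/eqP -> /eqP/IHl ->].
    by rewrite mul0r addr0.
  move: W'0; rewrite /S /T !wj0 W0 !addr0 => wi0.
  by rewrite [w i * _]mulrC [w i * _]mulrC !mulfK // gt_eqF.
have W0 : 0 < W by rewrite lt_neqAle eq_sym WN0.
have W'N0 : w i + W != 0 by rewrite gt_eqF.
have t01 : 0 <= w i / (w i + W) <= 1.
  by rewrite divr_ge0 ?(ltW W'0) //= ler_pdivrMr // mul1r lerDl.
have := @convex_powR R p p1 (Itv01 (proj1 (andP t01)) (proj2 (andP t01)))
  (v i) (S / W).
rewrite !inE /= !in_itv /= !andbT v0 divr_ge0 // => /(_ isT isT).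
rewrite [X in X `^ _ <= _ -> _]convRE [X in _ <= X -> _]convRE /= => H.
have E1 : unstable.onem (w i / (w i + W)) = W / (w i + W).
  by rewrite /unstable.onem; field.
rewrite E1 in H.
have -> : (w i * v i + S) / (w i + W) =
    w i / (w i + W) * v i + W / (w i + W) * (S / W) by field; rewrite WN0 W'N0.
apply: (le_trans H).
have -> : (w i * v i `^ p + T) / (w i + W) =
    w i / (w i + W) * v i `^ p + W / (w i + W) * (T / W) by field; rewrite WN0 W'N0.
by rewrite lerD2l ler_wpM2l ?divr_ge0 ?(ltW W'0) // IHr.
Qed.

End Jensen.

Section Hermitian.
Variable C : numClosedFieldType.
Local Open Scope sesquilinear_scope.

Lemma unitary_row_norm n (P : 'M[C]_n) i : P \is unitarymx ->
  \sum_k `|P i k| ^+ 2 = 1.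
Proof.
move=> /unitarymxP /matrixP /(_ i i); rewrite !mxE eqxx => PE; rewrite -[RHS]PE.
by apply: eq_bigr => k _; rewrite !mxE normCK.
Qed.

Lemma unitary_col_norm n (P : 'M[C]_n) k : P \is unitarymx ->
  \sum_i `|P i k| ^+ 2 = 1.
Proof.
rewrite -trmx_unitary => /(unitary_row_norm k) <-.
by apply: eq_bigr => i _; rewrite mxE.
Qed.

(** The same recursion as [texp], so that powers in the algebra and powers of truncations are
    compared by a single induction. *)
Definition mxpow n (A : 'M[C]_n) (k : nat) : 'M[C]_n := iter k (mulmx A) 1%:M.

Lemma mxpowS n (A : 'M[C]_n) k : mxpow A k.+1 = A *m mxpow A k.
Proof. by []. Qed.

Lemma mxpowSr n (A : 'M[C]_n) k : mxpow A k.+1 = mxpow A k *m A.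
Proof.
elim: k => [|k IHk]; first by rewrite /mxpow /= mulmx1 mul1mx.
by rewrite mxpowS {1}IHk mulmxA.
Qed.

Lemma trace_mxpow_mulC n (A B : 'M[C]_n) k :
  \tr (mxpow (A *m B) k) = \tr (mxpow (B *m A) k).
Proof.
case: k => // k.
have H j : A *m mxpow (B *m A) j = mxpow (A *m B) j *m A.
  elim: j => [|j IHj]; first by rewrite /mxpow /= mulmx1 mul1mx.
  by rewrite !mxpowS -!mulmxA -IHj !mulmxA.
by rewrite mxpowSr mulmxA -H mxtrace_mulC mulmxA mxpowS.
Qed.

Lemma herm_spectral n (W : 'M[C]_n) : W^t* = W ->
  W = (spectralmx W)^t* *m diag_mx (spectral_diag W) *m spectralmx W.
Proof.
move=> WH; have Wh : W \is hermsymmx.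
  by apply/is_hermitianmxP; rewrite expr0 scale1r WH.
have /orthomx_spectralP {1}-> := hermitian_normalmx Wh.
by rewrite invmx_unitary ?spectral_unitarymx.
Qed.

Lemma spectral_diag_real n (W : 'M[C]_n) i : W^t* = W ->
  spectral_diag W 0 i \is Num.real.
Proof.
move=> WH; apply: (mxOverP (hermitian_spectral_diag_real _)).
by apply/is_hermitianmxP; rewrite expr0 scale1r WH.
Qed.

Lemma mxpow_spectral n (W : 'M[C]_n) k : W^t* = W ->
  mxpow W k = (spectralmx W)^t* *m
    diag_mx (\row_i (spectral_diag W 0 i ^+ k)) *m spectralmx W.
Proof.
move=> WH; have Uu := spectral_unitarymx W.
elim: k => [|k IHk].
  rewrite (_ : \row__ _ = const_mx 1); last by apply/rowP => i; rewrite !mxE.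
  rewrite diag_const_mx mulmx1 -invmx_unitary // mulVmx //.
  exact: unitarymx_unit.
rewrite mxpowS IHk {1}(herm_spectral WH) !mulmxA (mulmxtVK _ Uu).
rewrite -(mulmxA _ (diag_mx _) (diag_mx _)) mulmx_diag.
congr (_ *m diag_mx _ *m _); apply/rowP => i.
by rewrite !mxE exprS.
Qed.

Lemma trace_mxpow_herm n (W : 'M[C]_n) k : W^t* = W ->
  \tr (mxpow W k) = \sum_i spectral_diag W 0 i ^+ k.
Proof.
move=> WH; have Uu := spectral_unitarymx W.
rewrite mxpow_spectral // mxtrace_mulC mulmxA.
rewrite (unitarymxP Uu) mul1mx mxtrace_diag.
by apply: eq_bigr => i _; rewrite mxE.
Qed.

(** Row [i] of the diagonalizing unitary is a left eigenvector; comparing its l^1 norm before and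
    after multiplication by [W] bounds the eigenvalue by the largest absolute row sum. *)
Lemma spectral_diag_le n (W : 'M[C]_n) (c : C) i : W^t* = W ->
  (forall a, \sum_b `|W a b| <= c) -> `|spectral_diag W 0 i| <= c.
Proof.
move=> WH Wc; have Uu := spectral_unitarymx W; set U := spectralmx W.
have UW : U *m W = diag_mx (spectral_diag W) *m U.
  by rewrite {1}(herm_spectral WH) !mulmxA (unitarymxP Uu) mul1mx.
have sum_ge0 b : 0 <= \sum_j `|W b j| by apply: sumr_ge0.
pose S := \sum_b `|U i b|.
have SN0 : 0 < S.
  rewrite lt_neqAle sumr_ge0 // andbT; apply/eqP => S0.
  have := unitary_row_norm i Uu; rewrite big1 => [/eqP|k _].
    by rewrite eq_sym oner_eq0.
  apply/eqP; rewrite sqrf_eq0; move/esym/eqP: S0.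
  by rewrite psumr_eq0 // => /allP /(_ k); rewrite mem_index_enum => /(_ isT).
rewrite -(ler_pM2r SN0) {1}/S mulr_sumr.
apply: (@le_trans _ _ (\sum_b \sum_j `|U i j| * `|W j b|)).
  apply: ler_sum => b _; have /matrixP /(_ i b) := UW.
  rewrite mul_diag_mx !mxE -normrM => <-.
  apply: (le_trans (ler_norm_sum _ _ _)).
  by apply: ler_sum => j _; rewrite normrM.
rewrite exchange_big /= mulr_sumr; apply: ler_sum => j _.
by rewrite -mulr_sumr mulrC ler_wpM2r.
Qed.

(* Peierls' argument: with [P] the unitary [V D U^t*] attached to each term, the
   eigenvalues of [Z] are doubly stochastic averages of those of [W]. *)
Lemma spectral_diag_avg n (W Z : 'M[C]_n) (s : seq (C * 'M[C]_n)) :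
  W^t* = W -> Z^t* = Z -> (forall t, t \in s -> t.2 \is unitarymx) ->
  Z = \sum_(t <- s) t.1 *: (t.2 *m W *m t.2^t*) ->
  exists2 P : C * 'M[C]_n -> 'M[C]_n, forall t, t \in s -> P t \is unitarymx &
    forall i, spectral_diag Z 0 i =
      \sum_(t <- s) t.1 * \sum_k `|P t i k| ^+ 2 * spectral_diag W 0 k.
Proof.
move=> WH ZH s0 ZE.
pose U := spectralmx W; pose V := spectralmx Z.
have Uu : U \is unitarymx by exact: spectral_unitarymx.
have Vu : V \is unitarymx by exact: spectral_unitarymx.
exists (fun t => V *m t.2 *m U^t*) => [t /s0 tu|i].
  by rewrite !mul_unitarymx // trmxC_unitary.
have : V *m Z *m V^t* = diag_mx (spectral_diag Z).
  rewrite {1}(herm_spectral ZH) !mulmxA (unitarymxP Vu) mul1mx.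
  by rewrite -mulmxA (unitarymxP Vu) mulmx1.
move=> /matrixP /(_ i i); rewrite [X in _ = X]mxE eqxx mulr1n => <-.
rewrite {1}ZE mulmx_sumr mulmx_suml summxE.
apply: eq_bigr => t _; rewrite -scalemxAr -scalemxAl mxE; congr (_ * _).
have -> : V *m (t.2 *m W *m t.2^t*) *m V^t* =
    (V *m t.2 *m U^t*) *m diag_mx (spectral_diag W) *m (V *m t.2 *m U^t*)^t*.
  rewrite {1}(herm_spectral WH) -/U !trmx_mul !map_mxM !trmxCK.
  by rewrite !mulmxA.
move: (V *m t.2 *m U^t*) => P.
rewrite mul_mx_diag mxE; apply: eq_bigr => k _.
by rewrite !mxE normCK mulrAC.
Qed.

(* The singular values of [X] are, up to sign and multiplicity two, the
   eigenvalues of the hermitian matrix [herm_dil X]. *)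
Definition herm_dil n (X : 'M[C]_n) : 'M[C]_(n + n) :=
  block_mx 0 X (X^t*) 0.

Lemma adj_block_mx m1 m2 n1 n2 (A : 'M[C]_(m1, n1)) (B : 'M[C]_(m1, n2))
    (A' : 'M[C]_(m2, n1)) (B' : 'M[C]_(m2, n2)) :
  (block_mx A B A' B')^t* = block_mx (A^t*) (A'^t*) (B^t*) (B'^t*).
Proof. by rewrite tr_block_mx map_block_mx. Qed.

Lemma adj_herm_dil n (X : 'M[C]_n) : (herm_dil X)^t* = herm_dil X.
Proof. by rewrite adj_block_mx !trmx0 !map_mx0 trmxCK. Qed.

Lemma herm_dil_sum n (I : Type) (r : seq I) (F : I -> 'M[C]_n) :
  herm_dil (\sum_(t <- r) F t) = \sum_(t <- r) herm_dil (F t).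
Proof.
elim: r => [|t r IHr].
  by rewrite !big_nil /herm_dil trmx0 map_mx0 block_mx0.
by rewrite !big_cons -IHr /herm_dil add_block_mx !addr0 linearD /= map_mxD.
Qed.

(** The square of the dilation is block diagonal with blocks [X X^*] and [X^* X], whose powers have
    equal traces; hence the factor 2. *)
Lemma trace_herm_dil n (X : 'M[C]_n) k :
  \sum_i (spectral_diag (herm_dil X) 0 i ^+ 2) ^+ k =
  2 * \tr (mxpow (X^t* *m X) k).
Proof.
under eq_bigr do rewrite -exprM.
rewrite -trace_mxpow_herm ?adj_herm_dil //.
have -> : mxpow (herm_dil X) (2 * k) =
    block_mx (mxpow (X *m X^t*) k) 0 0 (mxpow (X^t* *m X) k).
  elim: k => [|k IHk]; first by rewrite muln0 /mxpow /= -scalar_mx_block.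
  rewrite mulnS !mxpowS IHk mulmxA !mulmx_block.
  by rewrite !(mul0mx, mulmx0, addr0, add0r).
by rewrite mxtrace_block (trace_mxpow_mulC X) mulr_natl.
Qed.

Lemma herm_dil_eig_le n (X : 'M[C]_n) (c : C) i :
  (forall a, \sum_b `|X a b| <= c) -> (forall b, \sum_a `|X a b| <= c) ->
  `|spectral_diag (herm_dil X) 0 i| <= c.
Proof.
move=> rX cX; apply: spectral_diag_le; first exact: adj_herm_dil.
move=> a; rewrite big_split_ord /=; case: (split_ordP a) => a' ->.
  under eq_bigr do rewrite block_mxEul mxE normr0.
  rewrite big1 // add0r; under eq_bigr do rewrite block_mxEur.
  exact: rX.
rewrite addrC; under eq_bigr do rewrite block_mxEdr mxE normr0.
rewrite big1 // add0r; under eq_bigr do rewrite block_mxEdl !mxE norm_conjC.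
exact: cX.
Qed.

Lemma unitary_diag_mx n (d : 'rV[C]_n) : (forall a, `|d 0 a| = 1) ->
  diag_mx d \is unitarymx.
Proof.
move=> d1; apply/unitarymxP/matrixP => i j.
rewrite mul_diag_mx !mxE [j == i]eq_sym; case: eqP => [->|_].
  by rewrite mulr1n -normCK d1 expr1n.
by rewrite mulr0n conjC0 mulr0.
Qed.

(** The weights [t.1] are complex while averaging of eigenvalues needs nonnegative ones. The
    dilation absorbs the phase: the unitary with blocks [ph t.1 *: D] and [D] acts on the corner [X]
    by [ph t.1 *: D X D^*], which leaves the weight [|t.1|]. *)
Lemma herm_dil_avg n (X Y : 'M[C]_n) (s : seq (C * 'rV[C]_n)) :
  (forall t, t \in s -> forall a, `|t.2 0 a| = 1) ->
  Y = \sum_(t <- s) t.1 *: (diag_mx t.2 *m X *m (diag_mx t.2)^t*) ->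
  exists2 P : C * 'rV[C]_n -> 'M[C]_(n + n),
    forall t, t \in s -> P t \is unitarymx &
    forall i, spectral_diag (herm_dil Y) 0 i = \sum_(t <- s) `|t.1| *
      \sum_k `|P t i k| ^+ 2 * spectral_diag (herm_dil X) 0 k.
Proof.
move=> s1 YE.
(* The value 1 at [z = 0] keeps the modulus equal to one everywhere. *)
pose ph (z : C) : C := if z == 0 then 1 else z / `|z|.
have phE z : `|z| * ph z = z.
  rewrite /ph; case: eqVneq => [->|z0]; first by rewrite normr0 mul0r.
  by rewrite mulrC divfK // normr_eq0.
have ph1 z : `|ph z| = 1.
  rewrite /ph; case: eqVneq => [_|z0]; first exact: normr1.
  by rewrite normrM normfV normr_id divff // normr_eq0.
pose D (t : C * 'rV[C]_n) : 'rV[C]_(n + n) := row_mx (ph t.1 *: t.2) t.2.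
pose h (t : C * 'rV[C]_n) := (`|t.1|, diag_mx (D t)).
have [||t||P Pu PE] := @spectral_diag_avg _ (herm_dil X) (herm_dil Y) (map h s).
- exact: adj_herm_dil.
- exact: adj_herm_dil.
- move=> /mapP[u /s1 u1 ->] /=.
  apply: unitary_diag_mx => a; case: (split_ordP a) => a' ->.
    by rewrite row_mxEl mxE normrM ph1 u1 mulr1.
  by rewrite row_mxEr u1.
- rewrite big_map YE herm_dil_sum; apply: eq_bigr => t _ /=.
  rewrite /D diag_mx_row adj_block_mx !mulmx_block !trmx0 !map_mx0.
  rewrite !(mulmx0, mul0mx, addr0, add0r) scale_block_mx !scaler0.
  rewrite /herm_dil; congr block_mx.
    by rewrite linearZ /= -!scalemxAl scalerA phE.
  have adjM (A B : 'M[C]_n) : (A *m B)^t* = B^t* *m A^t*.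
    by rewrite trmx_mul map_mxM.
  have adjZ (a : C) (A : 'M[C]_n) : (a *: A)^t* = a^* *: A^t*.
    by rewrite linearZ /= map_mxZ.
  rewrite adjZ !adjM trmxCK linearZ /= adjZ -scalemxAr scalerA mulmxA.
  by rewrite -{1}(phE t.1) rmorphM /= conj_normC.
exists (P \o h) => [t ts|i]; first by apply: Pu; exact: map_f.
by rewrite PE big_map.
Qed.

End Hermitian.

(** * Peierls' inequality for real powers of singular values *)

Section DilationReal.
Variable R : realType.
Local Notation C := R[i].
Local Notation "x %:C" := (real_complex R x) (format "x %:C").
Local Open Scope sesquilinear_scope.

Lemma real_complex_sum (I : Type) (r : seq I) (F : I -> R) :
  (\sum_(i <- r) F i)%:C = \sum_(i <- r) (F i)%:C.
Proof. exact: (rmorph_sum (real_complex R)). Qed.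

Lemma real_complexM (x y : R) : (x * y)%:C = x%:C * y%:C.
Proof. exact: (rmorphM (real_complex R)). Qed.

Lemma real_complexX (x : R) k : (x ^+ k)%:C = x%:C ^+ k.
Proof. exact: (rmorphXn (real_complex R)). Qed.

Lemma Re_norm (z : C) : (complex.Re `|z|)%:C = `|z|.
Proof. by apply: RRe_real; exact: normr_real. Qed.

Definition dil_eig n (X : 'M[C]_n) (i : 'I_(n + n)) : R :=
  complex.Re (spectral_diag (herm_dil X) 0 i).

Lemma dil_eigE n (X : 'M[C]_n) i :
  (dil_eig X i)%:C = spectral_diag (herm_dil X) 0 i.
Proof. by apply: RRe_real; apply: spectral_diag_real; exact: adj_herm_dil. Qed.

Lemma sum_dil_eig n (X : 'M[C]_n) k :
  (\sum_i (dil_eig X i ^+ 2) ^+ k)%:C = 2 * \tr (mxpow (X^t* *m X) k).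
Proof.
rewrite -trace_herm_dil real_complex_sum; apply: eq_bigr => i _.
by rewrite !real_complexX dil_eigE.
Qed.

Lemma dil_eig_le n (X : 'M[C]_n) (c : R) i :
  (forall a, \sum_b `|X a b| <= c%:C) -> (forall b, \sum_a `|X a b| <= c%:C) ->
  `|dil_eig X i| <= c.
Proof.
move=> rX cX; rewrite -lecR; have := herm_dil_eig_le i rX cX.
by rewrite -dil_eigE normc_def /= expr0n addr0 sqrtr_sqr.
Qed.

(** The matrices [Q t] of squared moduli are doubly stochastic: unit row sums allow Jensen's
    inequality for each eigenvalue of [Y], and unit column sums make [Q] disappear once these are
    added up. The power [c ^ p] comes from normalizing the weights to total mass one. *)
Lemma dil_eig_powR_le n (X Y : 'M[C]_n) (s : seq (C * 'rV[C]_n)) (c p : R) :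
  1 <= p -> 0 < c ->
  (forall t, t \in s -> forall a, `|t.2 0 a| = 1) ->
  \sum_(t <- s) `|t.1| = c%:C ->
  Y = \sum_(t <- s) t.1 *: (diag_mx t.2 *m X *m (diag_mx t.2)^t*) ->
  \sum_i (dil_eig Y i ^+ 2) `^ (p / 2) <=
  c `^ p * \sum_i (dil_eig X i ^+ 2) `^ (p / 2).
Proof.
move=> p1 c0 s1 sc YE.
have sqE x : (x ^+ 2) `^ (p / 2) = `|x| `^ p :> R.
  rewrite -[x ^+ 2](ger0_norm (sqr_ge0 x)) normrX -powR_mulrn // -powRrM.
  by congr (_ `^ _); rewrite mulrC divfK // pnatr_eq0.
have sumE (Z : 'M[C]_n) : \sum_i (dil_eig Z i ^+ 2) `^ (p / 2) =
    \sum_i `|dil_eig Z i| `^ p by apply: eq_bigr => i _; exact: sqE.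
suff : \sum_i `|dil_eig Y i| `^ p <= c `^ p * \sum_i `|dil_eig X i| `^ p.
  by rewrite -(sumE X) -(sumE Y).
have [P Pu PE] := herm_dil_avg s1 YE.
pose Q t i k : R := complex.Re (`|P t i k|) ^+ 2.
have QE t i k : (Q t i k)%:C = `|P t i k| ^+ 2 by rewrite real_complexX Re_norm.
have Q0 t i k : 0 <= Q t i k by exact: sqr_ge0.
pose a (t : C * 'rV[C]_n) : R := complex.Re `|t.1|.
have a0 t : 0 <= a t by rewrite -ler0c Re_norm normr_ge0.
have eigE i : dil_eig Y i = \sum_(t <- s) a t * \sum_k Q t i k * dil_eig X k.
  apply: (@complexI R); rewrite -/(real_complex R _) dil_eigE PE real_complex_sum.
  apply: eq_bigr => t _; rewrite real_complexM Re_norm real_complex_sum.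
  congr (_ * _); apply: eq_bigr => k _.
  by rewrite real_complexM QE dil_eigE.
have sac : \sum_(t <- s) a t = c.
  apply: (@complexI R); rewrite -/(real_complex R _) real_complex_sum -[RHS]sc.
  by apply: eq_bigr => t _; exact: Re_norm.
have Qrow t i : t \in s -> \sum_k Q t i k = 1.
  move=> ts; apply: (@complexI R); rewrite -/(real_complex R _) real_complex_sum.
  rewrite -[RHS](unitary_row_norm i (Pu t ts)).
  by apply: eq_bigr => k _; exact: QE.
have Qcol t k : t \in s -> \sum_i Q t i k = 1.
  move=> ts; apply: (@complexI R); rewrite -/(real_complex R _) real_complex_sum.
  rewrite -[RHS](unitary_col_norm k (Pu t ts)).
  by apply: eq_bigr => i _; exact: QE.
have cN0 : c != 0 by rewrite gt_eqF.
pose w t := a t / c.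
have w0 t : 0 <= w t by rewrite divr_ge0 // ltW.
have w1 : \sum_(t <- s) w t = 1 by rewrite -mulr_suml sac divff.
have le1 i : `|dil_eig Y i| <=
    c * \sum_(t <- s) w t * \sum_k Q t i k * `|dil_eig X k|.
  rewrite eigE mulr_sumr; apply: (le_trans (ler_norm_sum _ _ _)).
  apply: ler_sum => t _.
  rewrite mulrA /w mulrCA divff // mulr1 normrM (ger0_norm (a0 t)).
  apply: ler_wpM2l => //; apply: (le_trans (ler_norm_sum _ _ _)).
  by apply: ler_sum => k _; rewrite normrM ger0_norm.
(* Jensen is applied twice: to the average over [s] with weights [w], then to the average over the
   eigenvalues of [X] with weights [Q t i]. *)
have le2 i : `|dil_eig Y i| `^ p <=
    c `^ p * \sum_(t <- s) w t * \sum_k Q t i k * `|dil_eig X k| `^ p.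
  have p0 : 0 <= p by rewrite (le_trans _ p1).
  have in0 t : 0 <= \sum_k Q t i k * `|dil_eig X k|.
    by apply: sumr_ge0 => k _; rewrite mulr_ge0.
  have sw0 : 0 <= \sum_(t <- s) w t * \sum_k Q t i k * `|dil_eig X k|.
    by apply: sumr_ge0 => t _; rewrite mulr_ge0.
  apply: (le_trans (ge0_ler_powR p0 _ _ (le1 i))).
  - by rewrite nnegrE.
  - by rewrite nnegrE mulr_ge0 // ltW.
  rewrite powRM ?(ltW c0) // ler_wpM2l ?powR_ge0 //.
  apply: (le_trans (powR_jensen p1 w0 in0 w1)).
  rewrite big_seq [leRHS]big_seq; apply: ler_sum => t ts.
  apply: ler_wpM2l => //; apply: (powR_jensen p1) => // ; exact: Qrow.
apply: (le_trans (ler_sum _ (fun i _ => le2 i))).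
rewrite -mulr_sumr ler_wpM2l ?powR_ge0 // exchange_big /=.
rewrite -[leRHS]mul1r -w1 mulr_suml.
rewrite big_seq [leRHS]big_seq; apply: ler_sum => t ts.
rewrite -mulr_sumr ler_wpM2l // exchange_big /=.
by apply: ler_sum => k _; rewrite -mulr_suml Qcol // mul1r.
Qed.

End DilationReal.

(** * Uniform polynomial approximation of real powers *)

Section Bernstein.
Variable R : realType.

(* [bern n g].[u] is the expectation of [g] at a sum of [n] independent
   Bernoulli variables of parameter [u]. *)
Fixpoint bern (n : nat) (g : nat -> R) : {poly R} :=
  if n is m.+1 then (1 - 'X) * bern m g + 'X * bern m (fun k => g k.+1)
  else (g 0%N)%:P.

Lemma bernS n g u : (bern n.+1 g).[u] =
  (1 - u) * (bern n g).[u] + u * (bern n (fun k => g k.+1)).[u].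
Proof. by rewrite /= !hornerE. Qed.

Lemma bern_le n g h u : 0 <= u <= 1 -> (forall k, (k <= n)%N -> g k <= h k) ->
  (bern n g).[u] <= (bern n h).[u].
Proof.
move=> /andP[u0 u1]; elim: n g h => [|n IHn] g h gh.
  by rewrite /= !hornerE gh.
rewrite !bernS lerD // ler_wpM2l ?subr_ge0 // IHn // => k kn; apply: gh => //.
by rewrite (leq_trans kn).
Qed.

Lemma bern_lin n a b g h u : (bern n (fun k => a * g k + b * h k)).[u] =
  a * (bern n g).[u] + b * (bern n h).[u].
Proof.
elim: n g h => [|n IHn] g h; first by rewrite /= !hornerE.
by rewrite !bernS !IHn; ring.
Qed.

Lemma bern_const n c u : (bern n (fun=> c)).[u] = c.
Proof.
elim: n => [|n IHn]; first by rewrite /= !hornerE.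
by rewrite bernS IHn; ring.
Qed.

(** Second moment of a binomial variable about [a]: squared bias plus variance. *)
Lemma bern_sqr n a u : (bern n (fun k => (k%:R - a) ^+ 2)).[u] =
  (n%:R * u - a) ^+ 2 + n%:R * u * (1 - u).
Proof.
elim: n a => [|n IHn] a; first by rewrite /= !hornerE; ring.
rewrite bernS IHn.
have -> : (bern n (fun k => (k.+1%:R - a) ^+ 2)).[u] =
          (bern n (fun k => (k%:R - (a - 1)) ^+ 2)).[u].
  congr (bern n _).[u]; apply/funext => k; rewrite -natr1; ring.
rewrite IHn -natr1; ring.
Qed.

Lemma mul_onem_le (u : R) : u * (1 - u) <= 1 / 2.
Proof. by have := sqr_ge0 (u - 1 / 2); nra. Qed.

(** Uniform continuity enters as a bound [e + K (u - v)^2]. This form passes directly through the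
    positive operator [bern], whose value on the quadratic is the variance, so no splitting into
    near and far nodes is required. *)
Lemma bernstein_approx (f : R -> R) (B : R) : 0 < B ->
  (forall e : R, 0 < e -> exists2 K : R, 0 <= K & forall u v : R, 0 <= u <= B ->
     0 <= v <= B -> `|f u - f v| <= e + K * (u - v) ^+ 2) ->
  forall e : R, 0 < e -> exists P : {poly R},
    forall s : R, 0 <= s <= B -> `|f s - P.[s]| <= e.
Proof.
move=> B0 fP e e0; have [|K K0 fK] := fP (e / 2); first by rewrite divr_gt0.
(* Chosen so that [K B^2 / n <= e]; as [u (1 - u) <= 1/2], the variance term costs at most
   [e / 2]. *)
pose n := (Num.truncn (K * B ^+ 2 / e)).+1.
have n0 : 0 < n%:R :> R by rewrite ltr0n.
have nK : K * B ^+ 2 / e < n%:R by rewrite /n truncnS_gt.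
pose g k := f (k%:R / n%:R * B).
exists (bern n g \Po (B^-1 *: 'X)) => s /andP[s0 sB].
rewrite horner_comp hornerZ hornerX; set u := B^-1 * s.
have sE : s = u * B by rewrite /u mulrAC mulVf ?mul1r // gt_eqF.
have u01 : 0 <= u <= 1.
  by rewrite /u mulr_ge0 ?invr_ge0 ?(ltW B0) //= mulrC ler_pdivrMr // mul1r.
pose h k := e / 2 * 1 + K * B ^+ 2 / n%:R ^+ 2 * ((k%:R - n%:R * u) ^+ 2).
have gh k : (k <= n)%N -> `|f s - g k| <= h k.
  move=> kn; have k01 : 0 <= k%:R / n%:R * B <= B.
    rewrite mulr_ge0 ?divr_ge0 ?ler0n ?(ltW B0) //=.
    by rewrite ler_piMl ?(ltW B0) // ler_pdivrMr // mul1r ler_nat.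
  apply: (le_trans (fK _ _ _ k01)); first by rewrite s0.
  rewrite /h mulr1 lerD2l le_eqVlt; apply/orP; left; apply/eqP.
  by rewrite sE; field; rewrite gt_eqF.
have bound : (bern n h).[u] <= e.
  rewrite /h bern_lin bern_const bern_sqr subrr expr0n add0r mulr1.
  have -> : K * B ^+ 2 / n%:R ^+ 2 * (n%:R * u * (1 - u)) =
            (K * B ^+ 2) / n%:R * (u * (1 - u)) by field; rewrite gt_eqF.
  have KB : K * B ^+ 2 / n%:R <= e.
    by rewrite ler_pdivrMr ?n0 // [e * _]mulrC -ler_pdivrMr // ltW.
  have KB0 : 0 <= K * B ^+ 2 / n%:R.
    by rewrite divr_ge0 ?ler0n // mulr_ge0 // sqr_ge0.
  have u4 := mul_onem_le u.
  have := ler_wpM2l KB0 u4; lra.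
have lin a b : (bern n (fun k => a * g k + b)).[u] = a * (bern n g).[u] + b.
  rewrite -[X in _ + X](bern_const n b u) -[X in _ + X]mul1r -bern_lin.
  by congr (bern n _).[u]; apply/funext => k; rewrite mul1r.
rewrite ler_norml; apply/andP; split.
- have := @bern_le n (fun k => 1 * g k + - f s) h u u01; rewrite lin => H.
  have : 1 * (bern n g).[u] - f s <= (bern n h).[u].
    by apply: H => k /gh; rewrite ler_norml; lra.
  by move: bound => h1 h2; lra.
- have := @bern_le n (fun k => -1 * g k + f s) h u u01; rewrite lin => H.
  have : -1 * (bern n g).[u] + f s <= (bern n h).[u].
    by apply: H => k /gh; rewrite ler_norml; lra.
  by move: bound => h1 h2; lra.
Qed.

(** Subadditivity of the concave power: the ratios [(u - v) / u] and [v / u] lie in [[0, 1]], where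
    [a <= a ^ r], and they add up to 1. *)
Lemma powR_sub_le (r u v : R) : 0 < r <= 1 -> 0 <= v <= u ->
  u `^ r - v `^ r <= (u - v) `^ r.
Proof.
move=> /andP[r0 r1] /andP[v0 vu].
have [u0|u0] := leP u 0.
  have -> : u = 0 by lra.
  have -> : v = 0 by lra.
  by rewrite [leLHS]subrr powR_ge0.
rewrite lerBlDr.
have le a : 0 <= a <= 1 -> a <= a `^ r.
  move=> /andP[a0 a1]; have [->|aN0] := eqVneq a 0; first exact: powR_ge0.
  by rewrite -{1}(powRr1 a0) ger_powR // lt_neqAle eq_sym aN0 a0.
have s1 : (u - v) / u + v / u = 1 by field; rewrite gt_eqF.
have h1 : (u - v) / u <= ((u - v) / u) `^ r.
  by apply: le; rewrite divr_ge0 ?subr_ge0 ?(ltW u0) //= ler_pdivrMr //; lra.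
have h2 : v / u <= (v / u) `^ r.
  by apply: le; rewrite divr_ge0 ?(ltW u0) //= ler_pdivrMr //; lra.
have E a : 0 <= a -> a `^ r = (a / u) `^ r * u `^ r.
  by move=> a0; rewrite -powRM ?divr_ge0 ?(ltW u0) // divfK // gt_eqF.
rewrite (E (u - v)) ?subr_ge0 // (E v) // -mulrDl ler_peMl ?powR_ge0 //.
by rewrite -s1 lerD.
Qed.

(** With [q = r N] and [r <= 1], the power is a Hölder function of exponent [r] followed by an
    [N]-th power, which is Lipschitz on a bounded interval. This handles [|u - v| <= dl]; beyond
    [dl] the quadratic term alone exceeds the oscillation [B ^ q]. *)
Lemma powR_modulus (q B : R) : 0 < q -> 0 < B -> forall e : R, 0 < e ->
  exists2 K : R, 0 <= K & forall u v : R, 0 <= u <= B -> 0 <= v <= B ->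
    `|u `^ q - v `^ q| <= e + K * (u - v) ^+ 2.
Proof.
move=> q0 B0 e e0; pose N := (Num.truncn q).+1; pose r := q / N%:R.
have N0 : 0 < N%:R :> R by rewrite ltr0n.
have r01 : 0 < r <= 1.
  rewrite /r divr_gt0 //= ler_pdivrMr // mul1r ltW // /N truncnS_gt //.
have r0 : 0 < r by case/andP: r01.
(* [H] bounds the bases [u ^ r], [L] is a Lipschitz constant of the [N]-th power on [[0, H]], and
   [dl] solves [L dl^r = e]. *)
pose H := B `^ r; have H0 : 0 < H by rewrite powR_gt0.
pose L := N%:R * H ^+ N.-1; have L0 : 0 < L by apply: mulr_gt0 => //; exact: exprn_gt0.
pose dl := (e / L) `^ r^-1; have dl0 : 0 < dl by apply: powR_gt0; exact: divr_gt0.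
pose F := B `^ q; exists (F / dl ^+ 2).
  by rewrite divr_ge0 ?powR_ge0 // sqr_ge0.
suff W u v : 0 <= v <= u -> u <= B ->
    `|u `^ q - v `^ q| <= e + F / dl ^+ 2 * (u - v) ^+ 2.
  move=> u v /andP[u0 uB] /andP[v0 vB]; have [uv|vu] := leP u v.
    by rewrite distrC -[(u - v) ^+ 2]sqrrN opprB; apply: W => //; rewrite u0.
  by apply: W => //; rewrite v0 ltW.
move=> /andP[v0 vu] uB; have u0 : 0 <= u by rewrite (le_trans v0).
have qn0 : q \is Num.nneg by rewrite nnegrE ltW.
have mono a b : 0 <= a -> a <= b -> a `^ q <= b `^ q.
  by move=> a0 ab; apply: ge0_ler_powR; rewrite ?nnegrE ?(ltW q0) // (le_trans a0).
have vq := mono _ _ v0 vu.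
rewrite ger0_norm ?subr_ge0 //.
have [small|large] := leP (u - v) dl; last first.
  have : 1 <= (u - v) ^+ 2 / dl ^+ 2.
    rewrite ler_pdivlMr ?exprn_gt0 // mul1r lerXn2r ?nnegrE ?(ltW dl0) ?(ltW large) //.
    by rewrite subr_ge0.
  have uF : u `^ q <= F by apply: mono.
  have v0' := powR_ge0 v q; have F0 : 0 <= F := powR_ge0 B q.
  have -> : F / dl ^+ 2 * (u - v) ^+ 2 = F * ((u - v) ^+ 2 / dl ^+ 2) by ring.
  by nra.
have E a : 0 <= a -> a `^ q = (a `^ r) ^+ N.
  by move=> a0; rewrite -powR_mulrn ?powR_ge0 // -powRrM /r divfK // gt_eqF.
have HE a : 0 <= a -> a <= B -> 0 <= a `^ r <= H.
  move=> a0 aB; rewrite powR_ge0 /=; apply: ge0_ler_powR => //; rewrite ?nnegrE // ltW //.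
have hu := HE _ u0 uB; have hv := HE _ v0 (le_trans vu uB).
apply: (@le_trans _ _ e); last first.
  by rewrite lerDl mulr_ge0 ?divr_ge0 ?powR_ge0 ?sqr_ge0.
rewrite !E // subrXX.
have hd : 0 <= u `^ r - v `^ r.
  by rewrite subr_ge0 ge0_ler_powR // ?nnegrE // ltW.
apply: (@le_trans _ _ ((u `^ r - v `^ r) * L)).
  rewrite ler_wpM2l // /L mulr_natl -[N in _ *+ N]card_ord -sumr_const.
  apply: ler_sum => i _; have iN : (i <= N.-1)%N by rewrite -ltnS.
  rewrite -[X in H ^+ X](subnK iN) exprD.
  case/andP: hu => hu0 huH; case/andP: hv => hv0 hvH.
  apply: ler_pM; rewrite ?exprn_ge0 //; apply: lerXn2r; rewrite ?nnegrE // ltW //.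
rewrite -ler_pdivlMr //; apply: (le_trans (powR_sub_le r01 _)).
  by rewrite v0.
have -> : e / L = dl `^ r.
  by rewrite /dl -powRrM mulVf ?gt_eqF // powRr1 // ltW // divr_gt0.
by apply: ge0_ler_powR; rewrite ?nnegrE ?subr_ge0 // ltW.
Qed.

Lemma powR_poly_approx (q B : R) : 0 < q -> 0 < B -> forall e : R, 0 < e ->
  exists P : {poly R}, forall s : R, 0 <= s <= B -> `|s `^ q - P.[s]| <= e.
Proof. by move=> q0 B0; apply: bernstein_approx => //; exact: powR_modulus. Qed.

End Bernstein.

(** * Realization of limits of empirical moments *)

Section Riemann.
Local Open Scope classical_set_scope.
Variable R : realType.
Local Notation leb := (@lebesgue_measure R).

Lemma lebesgue_cell (h : R -> R) (a b : R) : a <= b -> nondecreasing_fun h ->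
  (forall x, 0 <= h x) ->
  ((h a * (b - a))%:E <= \int[leb]_(x in `[a, b[) (h x)%:E)%E /\
  (\int[leb]_(x in `[a, b[) (h x)%:E <= (h b * (b - a))%:E)%E.
Proof.
move=> ab hd h0.
have mh (D : set R) : measurable D -> measurable_fun D (EFin \o h).
  by move=> mD; apply/measurable_EFinP; exact: nondecreasing_measurable.
have vol : leb `[a, b[ = (b - a)%:E.
  rewrite lebesgue_measure_itv /= lte_fin; case: ltP => // ba.
  by have -> : b = a by [apply/eqP; rewrite eq_le ab ba]; rewrite subrr.
have cE (c : R) : (\int[leb]_(x in `[a, b[) c%:E = (c * (b - a))%:E)%E.
  have -> : (fun=> c%:E) = (cst c%:E : R -> \bar R) by [].
  by rewrite integral_cst // [X in (_ * X)%E]vol EFinM.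
split; rewrite -cE; apply: ge0_le_integral => //.
- by move=> x _; rewrite lee_fin.
- exact: mh.
- by move=> x /=; rewrite in_itv /= => /andP[ax _]; rewrite lee_fin hd.
- by move=> x _; rewrite lee_fin.
- exact: mh.
- by move=> x /=; rewrite in_itv /= => /andP[_ xb]; rewrite lee_fin hd // ltW.
Qed.

Definition riemann_sum (n : nat) (h : R -> R) : R :=
  (\sum_(i < n) h (i%:R / n%:R)) / n%:R.

(** Left and right endpoint sums enclose the integral and, by telescoping, differ by at most
    [C / n]. The error depends on [h] only through [C], so it is uniform over all quantile
    functions. *)
Lemma riemann_sum_bounds (h : R -> R) (C : R) (n : nat) : (0 < n)%N ->
  nondecreasing_fun h -> (forall x, 0 <= h x <= C) ->
  ((riemann_sum n h)%:E <= \int[leb]_(x in `[0%R, 1%R]) (h x)%:E)%E /\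
  (\int[leb]_(x in `[0%R, 1%R]) (h x)%:E <= (riemann_sum n h + C / n%:R)%:E)%E.
Proof.
move=> n0 hd hC; have n0' : 0 < n%:R :> R by rewrite ltr0n.
have h0 x : 0 <= h x by case/andP: (hC x).
have mh (D : set R) : measurable D -> measurable_fun D (EFin \o h).
  by move=> mD; apply/measurable_EFinP; exact: nondecreasing_measurable.
pose p (j : nat) : R := j%:R / n%:R.
have pS j : p j.+1 - p j = n%:R^-1 by rewrite /p -natr1; field; rewrite gt_eqF.
have p_le j : p j <= p j.+1 by rewrite -subr_ge0 pS invr_ge0 ltW.
have p_ge0 j : 0 <= p j by rewrite /p divr_ge0.
have step j : ((\sum_(i < j) h (p i) / n%:R)%:E <=
      \int[leb]_(x in `[0%R, p j[) (h x)%:E)%E /\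
    (\int[leb]_(x in `[0%R, p j[) (h x)%:E <=
      (\sum_(i < j) h (p i.+1) / n%:R)%:E)%E.
  elim: j => [|j [IH1 IH2]].
    by rewrite !big_ord0 /p mul0r set_itvco0 integral_set0.
  have -> : `[0, p j.+1[%classic = `[0, p j[%classic `|` `[p j, p j.+1[%classic :> set R.
    by rewrite -itv_bndbnd_setU // bnd_simp.
  rewrite ge0_integral_setU //; last 3 first.
  - by apply: mh; exact: measurableU.
  - by move=> x _; rewrite lee_fin.
  - apply/disj_setPLR => x /=; rewrite !in_itv /= => /andP[_ xp].
    by rewrite (leNgt (p j)) xp.
  have [c1 c2] := lebesgue_cell (p_le j) hd h0; rewrite pS in c1 c2.
  by rewrite !big_ord_recr /= !EFinD; split; exact: leeD.
have pn : p n = 1 by rewrite /p divff // gt_eqF.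
have := step n; rewrite pn => -[s1 s2].
rewrite integral_itv_bndo_bndc in s1 s2; last exact: mh.
split; first by rewrite /riemann_sum mulr_suml.
apply: (le_trans s2); rewrite lee_fin /riemann_sum -!mulr_suml -mulrDl.
rewrite ler_wpM2r ?invr_ge0 ?(ltW n0') //.
case: n n0 {n0' pS p_le p_ge0 step s1 s2 pn} @p => // n _ p.
rewrite big_ord_recr big_ord_recl /=.
have C1 : h (p n.+1) <= C by case/andP: (hC (p n.+1)).
have C2 := h0 (0 / n.+1%:R).
under [X in _ <= _ + X + _]eq_bigr do rewrite -/(p _).
move: (\sum_(i < n) _) => S; lra.
Qed.

Lemma riemann_sum_close (h : R -> R) (C : R) (n : nat) : (0 < n)%N ->
  nondecreasing_fun h -> (forall x, 0 <= h x <= C) ->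
  `|fine (\int[leb]_(x in `[0%R, 1%R]) (h x)%:E) - riemann_sum n h| <= C / n%:R /\
  (\int[leb]_(x in `[0%R, 1%R]) (h x)%:E)%E \is a fin_num.
Proof.
move=> n0 hd hC; have [] := riemann_sum_bounds n0 hd hC.
case: (\int[leb]_(x in _) _)%E => [r| |];
  rewrite ?lee_fin ?leye_eq ?leeNy_eq //= => r1 r2; split => //.
by rewrite ger0_norm ?subr_ge0 // lerBlDl.
Qed.

End Riemann.

Section WeakLimit.
Local Open Scope classical_set_scope.
Variable R : realType.
Local Notation leb := (@lebesgue_measure R).

Definition avg (l : seq R) (g : R -> R) : R :=
  (\sum_(x <- l) g x) / (size l)%:R.

(** The default [B] is taken from [u = 1] on; being an upper bound of the list it keeps the function
    nondecreasing. Negative [u] are truncated to index 0. *)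
Definition quantile (B : R) (l : seq R) (u : R) : R :=
  nth B (sort <=%R l) (Num.truncn (u * (size l)%:R)).

Lemma quantile_bounds B l u : 0 <= B -> (forall x, x \in l -> 0 <= x <= B) ->
  0 <= quantile B l u <= B.
Proof.
move=> B0 lB; rewrite /quantile.
have [i_lt|i_ge] := ltnP (Num.truncn (u * (size l)%:R)) (size (sort <=%R l)).
  by apply: lB; rewrite -(mem_sort <=%R); exact: mem_nth.
by rewrite nth_default // lexx B0.
Qed.

Lemma quantile_nondecreasing B l : (forall x, x \in l -> 0 <= x <= B) ->
  nondecreasing_fun (quantile B l).
Proof.
move=> lB u v uv; rewrite /quantile.
have le_i : (Num.truncn (u * (size l)%:R) <= Num.truncn (v * (size l)%:R))%N.
  by apply: le_truncn; rewrite ler_wpM2r.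
have [i_lt|i_ge] := ltnP (Num.truncn (v * (size l)%:R)) (size (sort <=%R l)).
  have ss : sorted <=%R (sort <=%R l) by apply: sort_sorted; exact: le_total.
  apply: (sorted_leq_nth le_trans le_refl _ ss) => //.
  by rewrite inE (leq_ltn_trans le_i).
rewrite [leRHS]nth_default //.
have [j_lt|j_ge] := ltnP (Num.truncn (u * (size l)%:R)) (size (sort <=%R l)).
  have /lB /andP[] // : nth B (sort <=%R l) (Num.truncn (u * (size l)%:R)) \in l.
  by rewrite -(mem_sort <=%R); exact: mem_nth.
by rewrite nth_default.
Qed.

Lemma avg_quantile B l g : (0 < size l)%N ->
  avg l g = riemann_sum (size l) (fun u => g (quantile B l u)).
Proof.
move=> l0; rewrite /avg /riemann_sum; congr (_ / _).
rewrite -(perm_big _ (permEl (perm_sort <=%R l))) /= (big_nth B) size_sort big_mkord.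
apply: eq_bigr => i _; rewrite /quantile divfK ?pnatr_eq0 -?lt0n //.
by rewrite natrK.
Qed.

Lemma cvg_sumr (T I : Type) (F : set_system T) (r : seq I) (f : I -> T -> R)
    (a : I -> R) : Filter F -> (forall i, f i x @[x --> F] --> a i) ->
  \sum_(i <- r) f i x @[x --> F] --> \sum_(i <- r) a i.
Proof.
move=> FF fa; elim: r => [|i r IHr].
  rewrite big_nil (_ : (fun x => _) = cst 0); first exact: cvg_cst.
  by apply/funext => x; rewrite big_nil.
rewrite big_cons (_ : (fun x => _) = (fun x => f i x + \sum_(j <- r) f j x)).
  exact: cvgD.
by apply/funext => x; rewrite big_cons.
Qed.

Lemma ultra_limit (F : set_system nat) (a : nat -> R) (B : R) : UltraFilter F ->
  (forall i, 0 <= a i <= B) -> exists2 r, 0 <= r <= B & a i @[i --> F] --> r.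
Proof.
move=> FU aB; have := @segment_compact R 0 B; rewrite compact_ultra.
move=> /(_ (fmap a F)).
have FP : ProperFilter F by exact: ultra_proper.
case.
- split=> [|G GP sG]; first exact: fmap_proper_filter.
  apply/seteqP; split=> // A GA; rewrite /fmap /=.
  have [//|nA] := in_ultra_setVsetC (a @^-1` A) FU.
  exfalso; have : G (~` A) by apply: sG; rewrite /fmap /= preimage_setC.
  move=> GnA; apply: (@filter_not_empty _ G _).
  by rewrite -(setICr A); exact: filterI.
- apply: (@filterS _ F _ setT); last exact: filterT.
  by move=> i _; rewrite /= in_itv; exact: aB.
- by move=> r []; rewrite /= in_itv /= => rB cvr; exists r.
Qed.

(** The measure is the law of [q], a pointwise limit of quantile functions, under the uniform
    distribution on [[0, 1]]. Monotonicity survives the limit and gives measurability. It also makes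
    Riemann sums converge at a uniform rate, so that the integral of [q ^ k] is reached by taking
    limits at finitely many nodes only. *)
Lemma moments_realizable (l : nat -> seq R) (B : R) (m : nat -> R) : 0 <= B ->
  (forall M, (M < size (l M))%N) ->
  (forall M x, x \in l M -> 0 <= x <= B) ->
  (forall k, avg (l M) (fun s => s ^+ k) @[M --> \oo] --> m k) ->
  exists mu : probability R R, mu (~` [set s | 0 <= s <= B]) = 0%E /\
    forall k, (\int[mu]_(s in [set s | (0 <= s <= B)%R]) (s ^+ k)%:E)%E = (m k)%:E.
Proof.
move=> B0 lM lB lm.
(* One ultrafilter finer than [\oo] serves all [u] at once: no common subsequence is extracted, and
   the given limits of moments persist along it. *)
have [F [FU oF]] := @ultraFilterLemma nat \oo _.
have FP : ProperFilter F by exact: ultra_proper.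
have qP u : exists r : R, 0 <= r <= B /\ quantile B (l M) u @[M --> F] --> r.
  have [|r rB rl] := @ultra_limit F (fun M => quantile B (l M) u) B FU.
    by move=> M; apply: quantile_bounds; [|exact: lB].
  by exists r.
pose q u : R := sval (cid (qP u)).
have qB u : 0 <= q u <= B by rewrite /q; case: cid => r [].
have ql u : quantile B (l M) u @[M --> F] --> q u by rewrite /q; case: cid => r [].
have qnd : nondecreasing_fun q.
  move=> u v uv; apply: (ler_cvg_to (ql u) (ql v)).
  by apply: nearW => M; apply: quantile_nondecreasing => //; exact: lB.
have mq : measurable_fun [set: measurableTypeR R] (q : _ -> R).
  by exact: nondecreasing_measurable.
pose I := [set s : R | 0 <= s <= B].
have mI : measurable I.
  by have -> : I = `[0, B]%classic by [apply/seteqP; split=> s /=; rewrite in_itv].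
pose qm : {mfun measurableTypeR R >-> R} :=
  HB.pack q (isMeasurableFun.Build _ _ (measurableTypeR R) R q mq).
pose mu : probability R R := distribution (uniform_prob (@ltr01 R)) qm.
have qI : q @^-1` I = setT by apply/seteqP; split=> // u _; exact: qB.
exists mu; split.
  rewrite -[LHS]/(uniform_prob (@ltr01 R) (q @^-1` ~` I)).
  rewrite -(measure0 (uniform_prob (@ltr01 R))); congr (uniform_prob _ _).
  by apply/seteqP; split=> // u; case; exact: qB.
move=> k; pose h u := q u ^+ k.
have hnd : nondecreasing_fun h.
  move=> u v uv; apply: lerXn2r; rewrite ?nnegrE.
  - by case/andP: (qB u).
  - by case/andP: (qB v).
  - exact: qnd.
have powB x : 0 <= x <= B -> 0 <= x ^+ k <= B ^+ k.
  by case/andP=> x0 xB; rewrite exprn_ge0 // lerXn2r.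
have hB u : 0 <= h u <= B ^+ k by exact: powB.
have -> : (\int[mu]_(s in I) (s ^+ k)%:E)%E =
    (\int[leb]_(u in `[0%R, 1%R]) (h u)%:E)%E.
  rewrite ge0_integral_pushforward //=; last 2 first.
  - by apply: measurable_funTS; apply/measurable_EFinP; exact: exprn_measurable.
  - by move=> s; rewrite inE /= => /powB /andP[s0 _]; rewrite lee_fin.
  rewrite qI integral_uniform //; last 2 first.
  - apply/measurable_EFinP.
    exact: (nondecreasing_measurable (f := h)).
  - by move=> u; rewrite lee_fin; case/andP: (hB u).
  by rewrite subr0 invr1 mul1e.
have [_ hfin] := riemann_sum_close (ltn0Sn 0) hnd hB.
rewrite -(fineK hfin); congr EFin.
set J := fine _; apply/eqP; rewrite eq_sym -subr_eq0 -normr_le0; apply/ler_addgt0Pl => e e0.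
rewrite addr0.
(* Both distances from the [n]-node sum of [h], that of [J] and that of [m k], are at most
   [B ^ k / n <= e / 2]. *)
pose n := (Num.truncn (2 * B ^+ k / e)).+1.
have n0 : 0 < n%:R :> R by rewrite ltr0n.
have nB : B ^+ k / n%:R <= e / 2.
  rewrite ler_pdivrMr // mulrC mulrA ler_pdivlMr // -ler_pdivrMr //.
  by rewrite ltW // [B ^+ k * 2]mulrC /n truncnS_gt.
have [hc _] := riemann_sum_close (ltn0Sn (Num.truncn (2 * B ^+ k / e))) hnd hB.
suff mc : `|m k - riemann_sum n h| <= B ^+ k / n%:R.
  rewrite -/n -/J in hc.
  have -> : m k - J = (m k - riemann_sum n h) - (J - riemann_sum n h) by ring.
  apply: (le_trans (ler_normB _ _)); lra.
pose hM M u := quantile B (l M) u ^+ k.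
have hMnd M : nondecreasing_fun (hM M).
  move=> u v uv; apply: lerXn2r; rewrite ?nnegrE.
  - by case/andP: (quantile_bounds u B0 (lB M)).
  - by case/andP: (quantile_bounds v B0 (lB M)).
  - exact: quantile_nondecreasing (lB M) _ _ uv.
have hMB M u : 0 <= hM M u <= B ^+ k.
  by apply: powB; exact: quantile_bounds (lB M).
(* The Riemann sums of [hM M] with [n] nodes and with [size (l M)] nodes, the latter being the
   empirical moment, are both compared with the integral of [hM M]. *)
have close M : `|avg (l M) (fun s => s ^+ k) - riemann_sum n (hM M)| <=
    B ^+ k / n%:R + B ^+ k / M.+1%:R.
  have lM0 : (0 < size (l M))%N by rewrite (leq_ltn_trans _ (lM M)).
  rewrite (avg_quantile B) //.
  have [c1 _] := riemann_sum_close lM0 (hMnd M) (hMB M).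
  have [c2 _] := riemann_sum_close (ltn0Sn n.-1) (hMnd M) (hMB M).
  have c3 : B ^+ k / (size (l M))%:R <= B ^+ k / M.+1%:R.
    by rewrite ler_wpM2l ?exprn_ge0 // lef_pV2 ?posrE ?ltr0n // ler_nat.
  move: c1 c2; rewrite -/(hM M) prednK //; set I0 := fine _ => c1 c2.
  rewrite -[X in `|X|](_ : (I0 - riemann_sum n (hM M)) -
    (I0 - riemann_sum (size (l M)) (hM M)) = _); last by ring.
  apply: (le_trans (ler_normB _ _)); apply: lerD => //; exact: le_trans c3.
have rl : riemann_sum n (hM M) @[M --> F] --> riemann_sum n h.
  rewrite /riemann_sum; apply: cvgMr_tmp; apply: cvg_sumr => i.
  apply: (@cvg_comp _ _ _ (fun M => quantile B (l M) (i%:R / n%:R))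
    (fun s => s ^+ k) F (nbhs (q (i%:R / n%:R)))); first exact: ql.
  exact: exprn_continuous.
have ml : avg (l M) (fun s => s ^+ k) @[M --> F] --> m k by apply: cvg_trans (lm k); exact: cvg_app.
have cl : `|avg (l M) (fun s => s ^+ k) - riemann_sum n (hM M)| @[M --> F] -->
   `|m k - riemann_sum n h|.
  by apply: cvg_norm; exact: cvgB.
have bl : B ^+ k / n%:R + B ^+ k / M.+1%:R @[M --> F] --> B ^+ k / n%:R + B ^+ k * 0.
  apply: cvgD; first exact: cvg_cst.
  apply: cvgMl_tmp; apply: cvg_trans (@cvg_harmonic R); exact: cvg_app.
rewrite mulr0 addr0 in bl.
by apply: (ler_cvg_to cl bl); apply: nearW.
Qed.

End WeakLimit.

(** * Moments determine the averages of real powers *)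

Section MomentDetermined.
Local Open Scope classical_set_scope.
Variable R : realType.

Section Bounded.
Variables (mu : probability R R) (B : R) (B_ge0 : 0 <= B).
Let I := [set s : R | 0 <= s <= B].

Lemma measurable_segment : measurable I.
Proof.
by have -> : I = `[0, B]%classic by [apply/seteqP; split=> s /=; rewrite in_itv].
Qed.

Lemma integrable_bounded (f : R -> R) (K : R) : measurable_fun [set: R] f ->
  (forall s, I s -> `|f s| <= K) -> mu.-integrable I (EFin \o f).
Proof.
move=> mf fK; apply: measurable_bounded_integrable.
- exact: measurable_segment.
- exact: le_lt_trans (probability_le1 _ measurable_segment) (ltry 1).
- exact: measurable_funTS.
- exists K; split=> [|x Kx s Is]; first exact: num_real.
  by rewrite /= (le_trans (fK s Is)) // ltW.
Qed.

Lemma integrable_poly (P : {poly R}) :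
  mu.-integrable I (EFin \o (fun s => P.[s])).
Proof.
have -> : EFin \o (fun s => P.[s]) =
    fun s => (\sum_(i < size P) (P`_i * s ^+ i)%:E)%E.
  by apply/funext => s; rewrite /= horner_coef sumEFin.
apply: integrable_sum; first exact: measurable_segment.
move=> i _; apply: (@integrable_bounded (fun s => P`_i * s ^+ i) (`|P`_i| * B ^+ i)).
  apply: measurable_funM => //; exact: exprn_measurable.
move=> s /andP[s0 sB]; rewrite normrM ler_wpM2l // ger0_norm ?exprn_ge0 //.
by rewrite lerXn2r.
Qed.

Lemma Rintegral_poly (P : {poly R}) (m : nat -> R) :
  (forall k, (\int[mu]_(s in I) (s ^+ k)%:E)%E = (m k)%:E) ->
  (\int[mu]_(s in I) P.[s])%R = \sum_(i < size P) P`_i * m i.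
Proof.
move=> mE; rewrite /Rintegral.
under eq_integral do rewrite horner_coef -sumEFin.
have iX i : mu.-integrable I (EFin \o (fun s : R => s ^+ i)).
  have -> : (fun s : R => s ^+ i) = (fun s => ('X^i : {poly R}).[s]).
    by apply/funext => s; rewrite hornerXn.
  exact: integrable_poly.
rewrite integral_sum //=; first last.
- move=> i; under eq_fun do rewrite EFinM.
  apply: integrableZl (iX i); exact: measurable_segment.
- exact: measurable_segment.
rewrite (eq_bigr (fun i : 'I_(size P) => (P`_i * m i)%:E)) ?sumEFin // => i _.
under eq_integral do rewrite EFinM.
by rewrite (integralZl measurable_segment (iX i)) mE.
Qed.

Lemma Rintegral_le_poly (f : R -> R) (P : {poly R}) (e : R) :
  mu I = 1%E -> measurable_fun [set: R] f ->
  (forall s, I s -> `|f s - P.[s]| <= e) ->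
  `|\int[mu]_(s in I) f s - \int[mu]_(s in I) P.[s]| <= e.
Proof.
move=> muI mf fP; have e0 : 0 <= e.
  by apply: le_trans (normr_ge0 _) (fP 0 _); rewrite /I /= lexx.
have iP := integrable_poly P.
have icst (c : R) : mu.-integrable I (EFin \o cst c).
  by apply: (@integrable_bounded _ `|c|) => // s _; exact: lexx.
have [K [_ KP]] : [bounded P.[s] | s in I].
  exists (\sum_(i < size P) `|P`_i| * B ^+ i); split=> [|x Kx s Is]; first exact: num_real.
  apply: le_trans (ltW Kx); rewrite horner_coef.
  apply: le_trans (ler_norm_sum _ _ _) _; apply: ler_sum => i _.
  case/andP: Is => s0 sB; rewrite normrM ler_wpM2l // ger0_norm ?exprn_ge0 //.
  by rewrite lerXn2r.
have i_f : mu.-integrable I (EFin \o f).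
  apply: (@integrable_bounded _ (e + (K + 1))) => // s Is.
  have := KP (K + 1) _ s Is; rewrite ltrDl ltr01 => /(_ isT) /= KPs.
  have -> : f s = (f s - P.[s]) + P.[s] by rewrite subrK.
  by rewrite (le_trans (ler_normD _ _)) // lerD // fP.
have mI := measurable_segment.
have iPc (c : R) : mu.-integrable I (EFin \o (fun s => P.[s] + cst c s)).
  exact: (integrableD mI iP (icst c)).
have cE (c : R) : \int[mu]_(s in I) (cst c s) = c.
  by rewrite Rintegral_cst // [X in fine X]muI mulr1.
rewrite ler_norml; apply/andP; split.
- have : \int[mu]_(s in I) (P.[s] + cst (- e) s) <= \int[mu]_(s in I) f s.
    apply: (le_Rintegral mI (iPc _) i_f).
    by move=> s Is; have := fP s Is; rewrite ler_norml /=; lra.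
  by rewrite (RintegralD mI iP (icst _)) cE; lra.
- have : \int[mu]_(s in I) f s <= \int[mu]_(s in I) (P.[s] + cst e s).
    apply: (le_Rintegral mI i_f (iPc _)).
    by move=> s Is; have := fP s Is; rewrite ler_norml /=; lra.
  by rewrite (RintegralD mI iP (icst _)) cE; lra.
Qed.

End Bounded.

Lemma avg_le (l : seq R) (f g : R -> R) (e : R) : (0 < size l)%N ->
  (forall s, s \in l -> `|f s - g s| <= e) -> `|avg l f - avg l g| <= e.
Proof.
move=> l0 fg; have l0' : 0 < (size l)%:R :> R by rewrite ltr0n.
rewrite /avg -mulrBl -sumrB normrM [X in _ * X]ger0_norm ?invr_ge0 ?ler0n //.
rewrite ler_pdivrMr // (le_trans (ler_norm_sum _ _ _)) //.
move: fg; clear; elim: l => [|a l IHl] fg; first by rewrite big_nil mulr0.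
rewrite big_cons /= -natr1 mulrDr mulr1 addrC lerD //.
  by apply: IHl => s sl; apply: fg; rewrite inE sl orbT.
by apply: fg; rewrite inE eqxx.
Qed.

(** The limit is the same for every compactly supported measure with moments [m]; this is the form
    in which uniqueness of the spectral distribution is used. The bound [B'] of its support is
    independent of the bound [B] of the lists. *)
Lemma avg_powR_cvg (l : nat -> seq R) (B B' q : R) (m : nat -> R)
    (mu : probability R R) : 0 < q ->
  (forall M, (0 < size (l M))%N) ->
  (forall M x, x \in l M -> 0 <= x <= B) ->
  (forall k, avg (l M) (fun s => s ^+ k) @[M --> \oo] --> m k) ->
  mu (~` [set s | 0 <= s <= B']) = 0%E ->
  (forall k, (\int[mu]_(s in [set s | (0 <= s <= B')%R]) (s ^+ k)%:E)%E = (m k)%:E) ->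
  avg (l M) (fun s => s `^ q) @[M --> \oo] -->
    fine (\int[mu]_(s in [set s | (0 <= s)%R]) (s `^ q)%:E)%E.
Proof.
move=> q0 l0 lB lm muI mE; set I := [set s | 0 <= s <= B'] in muI mE *.
have mI : measurable I by exact: measurable_segment.
have muI1 : mu I = 1%E.
  have := probability_setC mu mI; rewrite muI => /esym/eqP.
  by rewrite sube_eq ?add0e // => /eqP.
have B'0 : 0 <= B'.
  rewrite leNgt; apply/negP => B'n; move: muI1.
  have -> : I = set0.
    by apply/seteqP; split=> // s /andP[s0 sB]; have := le_lt_trans (le_trans s0 sB) B'n; rewrite ltxx.
  by rewrite measure0 => /eqP; rewrite eq_sym onee_eq0.
have -> : (\int[mu]_(s in [set s | (0 <= s)%R]) (s `^ q)%:E =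
           \int[mu]_(s in I) (s `^ q)%:E)%E.
  have mJ : measurable [set s : R | 0 <= s].
    have -> : [set s : R | 0 <= s] = `[0, +oo[%classic.
      by apply/seteqP; split=> s /=; rewrite in_itv /= andbT.
    exact: measurable_itv.
  rewrite (ge0_negligible_integral (measurableC mI) mJ _ _ muI).
  - congr integral; apply/seteqP; split=> s /=.
      by case=> _ /contrapT.
    by move=> sI; split; [case/andP: sI|move=> nI; exact: nI].
  - apply/measurable_EFinP; apply: measurable_funTS; exact: measurable_powR.
  - by move=> s _; rewrite lee_fin powR_ge0.
(* A common interval for the lists and the measure; the 1 makes its length positive. The error [e]
   is shared by the integral, the moments and the empirical average. *)
pose C := Num.max (Num.max B B') 1; have C0 : 0 < C by rewrite lt_max ltr01 orbT.
apply/cvgrPdist_le => e e0.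
have [P PP] := powR_poly_approx q0 C0 (divr_gt0 e0 (ltr0n _ 3)).
have cP : avg (l M) (fun s => P.[s]) @[M --> \oo] --> \sum_(i < size P) P`_i * m i.
  rewrite (_ : (fun M => _) =
      fun M => \sum_(i < size P) P`_i * avg (l M) (fun s => s ^+ i)).
    by apply: cvg_sumr => i; apply: cvgMl_tmp; exact: lm.
  apply/funext => M; rewrite /avg; under eq_bigr do rewrite horner_coef.
  rewrite exchange_big /= mulr_suml; apply: eq_bigr => i _.
  by rewrite mulrA mulr_sumr.
have iP : `|\int[mu]_(s in I) (s `^ q) - \int[mu]_(s in I) P.[s]| <= e / 3.
  apply: (Rintegral_le_poly B'0 muI1 (measurable_powR q)).
  move=> s /andP[s0 sB]; apply: PP; rewrite s0 (le_trans sB) //.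
  by rewrite !le_max lexx orbT.
rewrite (Rintegral_poly B'0 _ mE) in iP.
have /cvgrPdist_le /(_ _ (divr_gt0 e0 (ltr0n _ 3))) := cP.
apply: filterS => M cM.
have aM : `|avg (l M) (fun s => s `^ q) - avg (l M) (fun s => P.[s])| <= e / 3.
  apply: avg_le => // s /lB /andP[s0 sB]; apply: PP; rewrite s0 (le_trans sB) //.
  by rewrite !le_max lexx.
move: iP cM aM; rewrite /Rintegral !ler_norml; lra.
Qed.

End MomentDetermined.

(** * Left multiplication on the quantum torus *)

Section TorusAlgebra.
Variable R : realType.
Local Notation C := R[i].
Local Notation "x %:C" := (real_complex R x) (format "x %:C").

Lemma cexpiD (a b : R) : cexpi (a + b) = cexpi a * cexpi b.
Proof. by rewrite /cexpi cosD sinD; congr Complex; rewrite addrC mulrC [X in _ + X]mulrC. Qed.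

Lemma cexpi0 : cexpi (0 : R) = 1.
Proof. by rewrite /cexpi cos0 sin0. Qed.

Lemma cexpiN (a : R) : cexpi (- a) = ((cexpi a)^*)%C.
Proof. by rewrite /cexpi cosN sinN. Qed.

Lemma norm_cexpi (a : R) : `|cexpi a| = 1.
Proof. by rewrite normc_def /= cos2Dsin2 sqrtr1. Qed.

Variables (n : nat) (theta : 'M[R]_n).
Implicit Types (a b g : 'rV[int]_n) (x y z : tpoly R n).

(** A bilinear form, so [phase] is a bicharacter, hence a 2-cocycle; [lmx_mul] rests on this. *)
Definition phase_exp a b : R := \sum_(j < n) \sum_(k < n | (j < k)%N)
  theta k j * (a ord0 k)%:~R * (b ord0 j)%:~R.

Lemma phaseE a b : phase theta a b = cexpi (2 * pi * phase_exp a b).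
Proof. by []. Qed.

Lemma phase_expDl a a' b : phase_exp (a + a') b = phase_exp a b + phase_exp a' b.
Proof.
rewrite /phase_exp -big_split; apply: eq_bigr => j _ /=.
rewrite -big_split; apply: eq_bigr => k _ /=.
by rewrite mxE rmorphD /= mulrDr mulrDl.
Qed.

Lemma phase_expDr a b b' : phase_exp a (b + b') = phase_exp a b + phase_exp a b'.
Proof.
rewrite /phase_exp -big_split; apply: eq_bigr => j _ /=.
rewrite -big_split; apply: eq_bigr => k _ /=.
by rewrite mxE rmorphD /= mulrDr.
Qed.

Lemma phaseDl a a' b : phase theta (a + a') b = phase theta a b * phase theta a' b.
Proof. by rewrite !phaseE phase_expDl mulrDr cexpiD. Qed.

Lemma phaseDr a b b' : phase theta a (b + b') = phase theta a b * phase theta a b'.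
Proof. by rewrite !phaseE phase_expDr mulrDr cexpiD. Qed.

Lemma phase_exp0l b : phase_exp 0 b = 0.
Proof. by apply: (addrI (phase_exp 0 b)); rewrite -phase_expDl !addr0. Qed.

Lemma phase_exp0r a : phase_exp a 0 = 0.
Proof. by apply: (addrI (phase_exp a 0)); rewrite -phase_expDr !addr0. Qed.

Lemma phase0l b : phase theta 0 b = 1.
Proof. by rewrite phaseE phase_exp0l mulr0 cexpi0. Qed.

Lemma phase0r a : phase theta a 0 = 1.
Proof. by rewrite phaseE phase_exp0r mulr0 cexpi0. Qed.

Lemma phaseNl a b : phase theta (- a) b = ((phase theta a b)^*)%C.
Proof.
rewrite !phaseE -cexpiN; congr cexpi; rewrite -mulrN; congr (_ * _).
by apply/eqP; rewrite -addr_eq0 -phase_expDl addNr phase_exp0l.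
Qed.

Lemma norm_phase a b : `|phase theta a b| = 1.
Proof. by rewrite phaseE norm_cexpi. Qed.

(* The matrix of left multiplication by [x] in the orthonormal basis [U^b]. *)
Definition lmx x g b : C := coef x (g - b) * phase theta (g - b) b.

Lemma lmxE x g b :
  lmx x g b = \sum_(t <- x) (if t.1 == g - b then t.2 * phase theta t.1 b else 0).
Proof.
rewrite /lmx /coef big_mkcond mulr_suml; apply: eq_bigr => t _.
by case: eqP => [->|_] //; rewrite mul0r.
Qed.

Lemma lmx_coef x a : lmx x a 0 = coef x a.
Proof. by rewrite /lmx subr0 phase0r mulr1. Qed.

Lemma lmx_diag x b : lmx x b b = ttau x.
Proof. by rewrite /lmx subrr phase0l mulr1. Qed.

Lemma lmx_one g b : lmx (tone R n) g b = (g == b)%:R.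
Proof.
rewrite lmxE /tone big_seq1 /= phase0l mulr1 eq_sym subr_eq0.
by case: eqP.
Qed.

Lemma lmx_adj x g b : lmx (tadj theta x) g b = ((lmx x b g)^*)%C.
Proof.
rewrite !lmxE /tadj big_map [RHS](rmorph_sum (@conjc R)); apply: eq_bigr => t _ /=.
rewrite eqr_oppLR opprB; case: eqP => [tE|_]; last first.
  by rewrite [RHS](rmorph0 (@conjc R)).
have -> : g = b - t.1 by rewrite tE opprB addrC subrK.
rewrite phaseDr [RHS](rmorphM (@conjc R)) -mulrA; congr (_ * _).
by rewrite [RHS](rmorphM (@conjc R)) phaseNl mulrC.
Qed.

(** Composition of left multiplications. In column [b] the matrix of [y] lives on [b] shifted by the
    multi-indices of [y], so any finite [s] containing these points can replace Z^n as range of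
    summation. *)
Lemma lmx_mul (s : seq 'rV[int]_n) x y g b : uniq s ->
  (forall t, t \in y -> b + t.1 \in s) ->
  \sum_(d <- s) lmx x g d * lmx y d b = lmx (tmul theta x y) g b.
Proof.
move=> us ys; rewrite lmxE /tmul big_allpairs_dep exchange_big /=.
under eq_bigr do rewrite (lmxE y) mulr_sumr.
rewrite exchange_big /= big_seq [RHS]big_seq; apply: eq_bigr => u uy.
rewrite (bigD1_seq (b + u.1)) ?ys //= [b + u.1 - b]addrAC subrr add0r eqxx.
rewrite big1 ?addr0 => [|d dN]; last first.
  case: eqP => [uE|_]; last by rewrite mulr0.
  by move: dN; rewrite uE addrC subrK eqxx.
rewrite lmxE mulr_suml; apply: eq_bigr => t _.
have -> : (t.1 == g - (b + u.1)) = (t.1 + u.1 == g - b).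
  by rewrite opprD addrA -(can2_eq (addrK u.1) (subrK u.1)).
case: eqP => _; last by rewrite mul0r.
rewrite phaseDr phaseDl; ring.
Qed.

Definition keys x : seq 'rV[int]_n := [seq t.1 | t <- x].

Lemma lmx_neq0 x g b : lmx x g b != 0 -> g - b \in keys x.
Proof.
rewrite lmxE; apply: contraNT => gb.
rewrite big_seq big1 // => t tx; case: eqP => // tE.
by case/negP: gb; rewrite -tE map_f.
Qed.

(** It depends on the representing list, and bounds all absolute row and column sums of the matrix
    of [x]. *)
Definition l1norm x : C := \sum_(t <- x) `|t.2|.

Lemma lmx_le x g b :
  `|lmx x g b| <= \sum_(t <- x) (if t.1 == g - b then `|t.2| else 0).
Proof.
rewrite lmxE; apply: (le_trans (ler_norm_sum _ _ _)); apply: ler_sum => t _.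
by case: eqP => _; rewrite ?normr0 // normrM norm_phase mulr1.
Qed.

Lemma sum_delta_le (T : eqType) (s : seq T) (d : T) (c : C) : uniq s -> 0 <= c ->
  \sum_(b <- s) (if b == d then c else 0) <= c.
Proof.
move=> us c0; have [ds|ds] := boolP (d \in s).
  by rewrite (bigD1_seq d) //= eqxx big1 ?addr0 // => b /negbTE ->.
rewrite big_seq big1 // => b bs; case: eqP => // bd.
by rewrite -bd bs in ds.
Qed.

Lemma lmx_row_sum (s : seq 'rV[int]_n) x g : uniq s ->
  \sum_(b <- s) `|lmx x g b| <= l1norm x.
Proof.
move=> us; apply: (le_trans (ler_sum _ (fun b _ => lmx_le x g b))).
rewrite exchange_big; apply: ler_sum => t _ /=.
rewrite (eq_bigr (fun b => if b == g - t.1 then `|t.2| else 0)); last first.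
  move=> b _; congr (if _ then _ else _).
  by rewrite eq_sym subr_eq [b == _]eq_sym subr_eq addrC.
exact: sum_delta_le.
Qed.

Lemma lmx_col_sum (s : seq 'rV[int]_n) x b : uniq s ->
  \sum_(g <- s) `|lmx x g b| <= l1norm x.
Proof.
move=> us; apply: (le_trans (ler_sum _ (fun g _ => lmx_le x g b))).
rewrite exchange_big; apply: ler_sum => t _ /=.
rewrite (eq_bigr (fun g => if g == t.1 + b then `|t.2| else 0)); last first.
  by move=> g _; rewrite eq_sym subr_eq.
exact: sum_delta_le.
Qed.

Definition in_radius (r : nat) x :=
  forall t, t \in x -> forall j, (`|t.1 ord0 j| <= r)%N.

Lemma in_radius_adj r x : in_radius r x -> in_radius r (tadj theta x).
Proof. by move=> xr t /mapP[u /xr ur ->] j /=; rewrite mxE abszN. Qed.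

Lemma in_radius_mul r r' x y : in_radius r x -> in_radius r' y ->
  in_radius (r + r') (tmul theta x y).
Proof.
move=> xr yr t /allpairsP[[u v] /= [/xr ur /yr vr ->]] j /=.
rewrite mxE -lez_nat PoszD abszE (le_trans (ler_normD _ _)) //.
by rewrite lerD // -abszE lez_nat.
Qed.

Lemma in_radius_exp r x k : in_radius r x -> in_radius (r * k) (texp theta x k).
Proof.
move=> xr; elim: k => [|k IHk].
  by move=> t; rewrite inE => /eqP -> j; rewrite mxE.
rewrite mulnS; exact: in_radius_mul.
Qed.

Lemma radius_exists x : exists r, in_radius r x.
Proof.
elim: x => [|t x [r xr]]; first by exists 0%N.
exists (r + \sum_(j < n) `|t.1 ord0 j|)%N => u; rewrite inE => /orP[/eqP ->|/xr ur] j.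
  by rewrite (bigD1 j) //=; lia.
by rewrite (leq_trans (ur j)) // leq_addr.
Qed.

End TorusAlgebra.

(** * Truncation to boxes *)

Section Box.
Variable R : realType.
Local Notation C := R[i].
Local Notation "x %:C" := (real_complex R x) (format "x %:C").
Local Open Scope sesquilinear_scope.
Variables (n : nat) (theta : 'M[R]_n) (m : nat).

Notation box := {ffun 'I_n -> 'I_m}.

Definition box_pt (i : 'I_#|{: box}|) : 'rV[int]_n :=
  \row_j (enum_val i j : nat)%:Z.

Lemma box_pt_inj : injective box_pt.
Proof.
move=> i i' /rowP E; apply: enum_val_inj; apply/ffunP => j; apply: val_inj.
by have := E j; rewrite !mxE => -[].
Qed.

Definition box_seq : seq 'rV[int]_n := [seq box_pt i | i <- enum 'I_#|{: box}|].

Lemma uniq_box_seq : uniq box_seq.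
Proof. by rewrite map_inj_uniq ?enum_uniq //; exact: box_pt_inj. Qed.

Lemma mem_box_seq (b : 'rV[int]_n) :
  (forall j, 0 <= b ord0 j < m%:Z) -> b \in box_seq.
Proof.
move=> bm; have bj j : (`|b ord0 j| < m)%N.
  by have := bm j; case: (b ord0 j) => k //=.
pose f : box := [ffun j => Ordinal (bj j)].
apply/mapP; exists (enum_rank f); first by rewrite mem_enum.
apply/rowP => j; rewrite mxE enum_rankK ffunE /=.
by rewrite gez0_abs ?ord1 //; case/andP: (bm j).
Qed.

Lemma big_box_seq (V : nmodType) (F : 'rV[int]_n -> V) :
  \sum_(b <- box_seq) F b = \sum_i F (box_pt i).
Proof. by rewrite big_map big_enum. Qed.

Definition trunc_mx (x : tpoly R n) : 'M[C]_#|{: box}| :=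
  \matrix_(a, b) lmx theta x (box_pt a) (box_pt b).

Lemma adj_trunc_mx x : (trunc_mx x)^t* = trunc_mx (tadj theta x).
Proof. by apply/matrixP => a b; rewrite !mxE lmx_adj. Qed.

Lemma trunc_mx_row x a : \sum_b `|trunc_mx x a b| <= l1norm x.
Proof.
under eq_bigr do rewrite mxE.
rewrite -(big_box_seq (fun b => `|lmx theta x (box_pt a) b|)).
exact: lmx_row_sum uniq_box_seq.
Qed.

Lemma trunc_mx_col x b : \sum_a `|trunc_mx x a b| <= l1norm x.
Proof.
under eq_bigr do rewrite mxE.
rewrite -(big_box_seq (fun a => `|lmx theta x a (box_pt b)|)).
exact: lmx_col_sum uniq_box_seq.
Qed.

Definition interior (r : nat) (i : 'I_#|{: box}|) : Prop :=
  forall j, (r <= enum_val i j)%N /\ (enum_val i j + r < m)%N.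

Lemma interior_shift r i (a : 'rV[int]_n) : interior r i ->
  (forall j, (`|a ord0 j| <= r)%N) -> box_pt i + a \in box_seq.
Proof.
move=> ir ar; apply: mem_box_seq => j; rewrite !mxE.
move: (ir j) (ar j); move: (nat_of_ord _) (a ord0 j) => v w [h1 h2] h3; lia.
Qed.

Lemma interior_near r r' i i' : interior (r + r') i ->
  (forall j, (`|((box_pt i' - box_pt i)%R ord0 j)| <= r)%N) -> interior r' i'.
Proof.
move=> ir near_ii' j; move: (ir j) (near_ii' j); rewrite !mxE.
move: (nat_of_ord (enum_val i j)) (nat_of_ord (enum_val i' j)) => v w [h1 h2] h3.
by lia.
Qed.

Lemma interior_le r r' i : (r' <= r)%N -> interior r i -> interior r' i.
Proof. by move=> rr' ir j; have [h1 h2] := ir j; split; lia. Qed.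

Lemma trunc_mx_mul r x y a b : in_radius r y -> interior r b ->
  (trunc_mx x *m trunc_mx y) a b =
  lmx theta (tmul theta x y) (box_pt a) (box_pt b).
Proof.
move=> yr br; rewrite mxE -(lmx_mul theta x (box_pt a) uniq_box_seq).
  by rewrite big_box_seq; apply: eq_bigr => d _; rewrite !mxE.
by move=> t /yr tr; exact: interior_shift br tr.
Qed.

(* Far from the boundary of the box the truncation is invisible: the entries of
   powers of [X^* X] only involve short paths. *)
Lemma trunc_mx_pow r x k a b : in_radius r x -> interior ((r + r) * k) b ->
  mxpow ((trunc_mx x)^t* *m trunc_mx x) k a b =
  lmx theta (texp theta (tmul theta (tadj theta x) x) k) (box_pt a) (box_pt b).
Proof.
move=> xr; set z := tmul theta (tadj theta x) x.
have zr : in_radius (r + r) z.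
  by apply: in_radius_mul => //; exact: in_radius_adj.
have zkr j := in_radius_exp (theta := theta) (k := j) zr.
elim: k a => [|k IHk] a bk.
  by rewrite lmx_one mxE (inj_eq box_pt_inj).
have bk' : interior ((r + r) * k) b by apply: interior_le bk; lia.
rewrite mxpowS mxE [RHS]/= -/(texp theta z k).
rewrite -(lmx_mul theta z (box_pt a) uniq_box_seq (b := box_pt b)); last first.
  by move=> t /zkr tr; exact: interior_shift bk' tr.
rewrite big_box_seq; apply: eq_bigr => d _; rewrite (IHk d bk').
have [->|N0] := eqVneq (lmx theta (texp theta z k) (box_pt d) (box_pt b)) 0.
  by rewrite !mulr0.
congr (_ * _); rewrite adj_trunc_mx; apply: (trunc_mx_mul _ _ xr).
(* A nonzero entry places [d] within [(r + r) * k] of [b], so [d] keeps a margin [r], which suffices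
   for one more product [X^* X]. *)
apply: (@interior_near ((r + r) * k) r b).
  by apply: interior_le bk; lia.
have /mapP[t tz ->] := lmx_neq0 N0.
by move=> j; exact: zkr tz j.
Qed.

Lemma mxpow_row_sum N (A : 'M[C]_N) (c : C) k a :
  (forall i, \sum_j `|A i j| <= c) -> \sum_j `|mxpow A k a j| <= c ^+ k.
Proof.
move=> Ac; have c0 : 0 <= c by apply: le_trans (Ac a); exact: sumr_ge0.
elim: k a => [|k IHk] a.
  rewrite expr0 (bigD1 a) //= mxE eqxx normr1 big1 ?addr0 // => j ja.
  by rewrite mxE eq_sym (negbTE ja) normr0.
rewrite mxpowS; apply: (@le_trans _ _ (\sum_j \sum_d `|A a d| * `|mxpow A k d j|)).
  apply: ler_sum => j _; rewrite mxE; apply: (le_trans (ler_norm_sum _ _ _)).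
  by apply: ler_sum => d _; rewrite normrM.
rewrite exchange_big /=; apply: (@le_trans _ _ (\sum_d `|A a d| * c ^+ k)).
  by apply: ler_sum => d _; rewrite -mulr_sumr ler_wpM2l.
by rewrite -mulr_suml exprS ler_wpM2r // exprn_ge0.
Qed.

Lemma trunc_mx_pow_entry x k a :
  `|mxpow ((trunc_mx x)^t* *m trunc_mx x) k a a| <= (l1norm x * l1norm x) ^+ k.
Proof.
have l0 : 0 <= l1norm x by apply: sumr_ge0.
set A := _ *m _; apply: (@le_trans _ _ (\sum_j `|mxpow A k a j|)).
  by rewrite (bigD1 a) //= lerDl sumr_ge0.
apply: mxpow_row_sum => i; rewrite /A.
 apply: (@le_trans _ _ (\sum_j \sum_d `|trunc_mx x d i| * `|trunc_mx x d j|)).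
    apply: ler_sum => j _; rewrite mxE; apply: (le_trans (ler_norm_sum _ _ _)).
    apply: ler_sum => d _; rewrite normrM; apply: ler_wpM2r => //.
    by rewrite [_^t* _ _]mxE [_^T _ _]mxE norm_conjC.
  rewrite exchange_big /=.
  apply: (@le_trans _ _ (\sum_d `|trunc_mx x d i| * l1norm x)).
    apply: ler_sum => d _; rewrite -mulr_sumr ler_wpM2l //; exact: trunc_mx_row.
  rewrite -mulr_suml; apply: ler_wpM2r => //; exact: trunc_mx_col.
Qed.

Definition interiorb (r : nat) (i : 'I_#|{: box}|) : bool :=
  [forall j, (r <= enum_val i j)%N && (enum_val i j + r < m)%N].

Lemma interiorP r i : reflect (interior r i) (interiorb r i).
Proof.
by apply: (iffP forallP) => h j; have := h j; [move/andP|move=> /andP].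
Qed.

Lemma card_interior r : #|[pred i | interiorb r i]| = ((m - r - r) ^ n)%N.
Proof.
pose A := [pred k : 'I_m | (r <= k)%N && (k + r < m)%N].
have -> : #|[pred i | interiorb r i]| = #|ffun_on A : pred box|.
  rewrite -(card_imset _ enum_val_inj); apply: eq_card => f.
  apply/imsetP/ffun_onP => [[i ir ->] j|fA].
    by have /forallP/(_ j) := ir.
  exists (enum_rank f); last by rewrite enum_rankK.
  by rewrite inE; apply/forallP => j; rewrite enum_rankK; exact: fA.
rewrite card_ffun_on card_ord; congr (_ ^ _)%N.
rewrite -sum1_card -(big_mkord (fun k => (r <= k) && (k + r < m))%N (fun=> 1%N)).
rewrite -[RHS]mul1n mulnC -sum_nat_const_nat.
rewrite [RHS](big_nat_widen _ _ m) ?leq_subr // [RHS](big_nat_widenl _ 0) //.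
by apply: eq_bigl => k; rewrite /=; lia.
Qed.

End Box.

(** * Convergence of normalized traces *)

Section TraceLimit.
Variable R : realType.
Local Notation C := R[i].
Local Notation "x %:C" := (real_complex R x) (format "x %:C").
Local Open Scope sesquilinear_scope.
Local Open Scope classical_set_scope.
Variables (n : nat) (n_gt0 : (0 < n)%N) (theta : 'M[R]_n).

(** Every squared singular value is listed twice, once for each sign in the spectrum of the
    dilation; averages are unaffected. *)
Definition sq_sing (x : tpoly R n) (M : nat) : seq R :=
  [seq dil_eig (trunc_mx theta M.+1 x) i ^+ 2 |
    i <- enum 'I_(#|{: {ffun 'I_n -> 'I_M.+1}}| + #|{: {ffun 'I_n -> 'I_M.+1}}|)].

Lemma card_box M : #|{: {ffun 'I_n -> 'I_M.+1}}| = (M.+1 ^ n)%N.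
Proof. by rewrite card_ffun !card_ord. Qed.

Lemma size_sq_sing x M : size (sq_sing x M) = (M.+1 ^ n + M.+1 ^ n)%N.
Proof. by rewrite size_map size_enum_ord card_box. Qed.

Lemma sq_sing_size_gt x M : (M < size (sq_sing x M))%N.
Proof.
rewrite size_sq_sing; apply: leq_trans (leq_addr _ _).
by apply: leq_trans (leq_pexp2l _ n_gt0); rewrite ?expn1.
Qed.

Definition l1normr (x : tpoly R n) : R := complex.Re (l1norm x).

Lemma l1normrE x : (l1normr x)%:C = l1norm x.
Proof.
by apply: RRe_real; apply: ger0_real; apply: sumr_ge0 => t _; exact: normr_ge0.
Qed.

Lemma sq_sing_bounds x M s : s \in sq_sing x M -> 0 <= s <= l1normr x ^+ 2.
Proof.
case/mapP => i _ ->; rewrite sqr_ge0 /=.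
have le : `|dil_eig (trunc_mx theta M.+1 x) i| <= l1normr x.
  apply: dil_eig_le => a; rewrite l1normrE;
    [exact: trunc_mx_row|exact: trunc_mx_col].
rewrite -[leLHS]ger0_norm ?sqr_ge0 // normrX lerXn2r // nnegrE //.
exact: le_trans (normr_ge0 _) le.
Qed.

Lemma avg_sq_sing x M k : avg (sq_sing x M) (fun s => s ^+ k) =
  complex.Re (\tr (mxpow ((trunc_mx theta M.+1 x)^t* *m trunc_mx theta M.+1 x) k))
  / (M.+1 ^ n)%:R.
Proof.
rewrite /avg size_sq_sing big_map big_enum /=.
set X := trunc_mx _ _ _; have := sum_dil_eig X k.
set S := \sum_i _; set T := \tr _ => E.
have {E} -> : S = 2 * complex.Re T.
  have := congr1 (@complex.Re R) E; rewrite /= => ->.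
  by rewrite mulr2n mulrDl !mul1r raddfD /= mulr2n mulrDl !mul1r.
by rewrite addnn -mul2n natrM; field; rewrite pnatr_eq0 expn_eq0.
Qed.

(** The Følner property of boxes: the proportion of points within a fixed distance of the boundary
    tends to 0. *)
Lemma interior_fraction r :
  ((M.+1 - r - r) ^ n)%:R / (M.+1 ^ n)%:R @[M --> \oo] --> (1 : R).
Proof.
have H : ((M.+1 - r - r)%:R / M.+1%:R : R) @[M --> \oo] --> (1 : R).
  apply/cvgrPdist_le => e e0.
  have h : (r + r)%:R * @harmonic R M @[M --> \oo] --> ((r + r)%:R * 0 : R).
    by apply: cvgMl_tmp; exact: cvg_harmonic.
  rewrite mulr0 in h; have /cvgrPdist_le /(_ e e0) := h.
  apply: filterS => M; rewrite /= sub0r normrN ger0_norm ?mulr_ge0 ?invr_ge0 // => hM.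
  have -> : 1 - (M.+1 - r - r)%:R / M.+1%:R =
     (M.+1 - (M.+1 - r - r))%:R / M.+1%:R :> R.
    rewrite [in RHS]natrB; last by lia.
    by rewrite mulrBl divff // pnatr_eq0.
  rewrite ger0_norm ?divr_ge0 //; apply: le_trans hM.
  by rewrite ler_wpM2r ?invr_ge0 // ler_nat; lia.
rewrite (_ : (fun M => _) = (fun M => ((M.+1 - r - r)%:R / M.+1%:R) ^+ n : R)).
  have := @cvg_comp _ _ _ (fun M => (M.+1 - r - r)%:R / M.+1%:R : R)
    (fun s : R => s ^+ n) \oo (nbhs (1 : R)) _ H (@exprn_continuous R n 1).
  by rewrite expr1n.
by apply/funext => M; rewrite !natrX expr_div_n.
Qed.

(** At an interior point the diagonal entry equals the trace of the torus exactly; at the remaining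
    points the discrepancy is at most a bound that does not depend on [M]. *)
Lemma avg_sq_sing_close x r k M : in_radius r x ->
  `|moment theta x k - avg (sq_sing x M) (fun s => s ^+ k)| <=
  (1 - ((M.+1 - (r + r) * k - (r + r) * k) ^ n)%:R / (M.+1 ^ n)%:R) *
  ((l1normr x * l1normr x) ^+ k +
   complex.Re `|ttau (texp theta (tmul theta (tadj theta x) x) k)|).
Proof.
move=> xr; rewrite avg_sq_sing /moment; set tau := ttau _.
set A := _ *m _; set rho := ((r + r) * k)%N; set N := (M.+1 ^ n)%N.
set K := (l1normr x * l1normr x) ^+ k + _.
have N0 : 0 < N%:R :> R by rewrite ltr0n expn_gt0.
have KE : K%:C = (l1norm x * l1norm x) ^+ k + `|tau|.
  rewrite /K [LHS](rmorphD (real_complex R)) /= Re_norm real_complexX.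
  by rewrite real_complexM l1normrE.
have entry b : `|tau - mxpow A k b b| <=
    (if interiorb rho b then 0 else K)%:C.
  case: ifPn => [/interiorP bi|_].
    by rewrite /A (trunc_mx_pow theta b xr bi) lmx_diag subrr normr0.
  rewrite KE [leRHS]addrC; apply: (le_trans (ler_normB _ _)); rewrite lerD2l.
  exact: trunc_mx_pow_entry.
have trE : N%:R * tau - \tr (mxpow A k) = \sum_b (tau - mxpow A k b b).
  rewrite sumrB sumr_const card_ord -[X in _ = X - _]mulr_natl.
  by congr (_%:R * _ - _); rewrite card_box.
have -> : complex.Re tau - complex.Re (\tr (mxpow A k)) / N%:R =
    complex.Re (N%:R * tau - \tr (mxpow A k)) / N%:R.
  have -> : N%:R * tau = (N%:R)%:C * tau by rewrite (rmorph_nat (real_complex R)).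
  case: (tau) (\tr _) => [a b] [c d] /=; rewrite mul0r subr0; field.
  by rewrite gt_eqF.
rewrite normrM [X in _ * X]ger0_norm ?invr_ge0 ?(ltW N0) // ler_pdivrMr //.
rewrite -lecR; apply: (le_trans (normc_ge_Re _)); rewrite trE.
apply: (le_trans (ler_norm_sum _ _ _)); apply: (le_trans (ler_sum _ (fun b _ => entry b))).
rewrite -real_complex_sum lecR.
rewrite (eq_bigr (fun b => K - (if interiorb rho b then K else 0))); last first.
  by move=> b _; case: ifP => _; rewrite ?subrr ?subr0.
rewrite sumrB -big_mkcond !sumr_const [X in _ - K *+ X]card_interior.
rewrite card_ord card_box.
rewrite -/N -/rho -[K *+ N]mulr_natr -[K *+ _]mulr_natr.
rewrite le_eqVlt; apply/orP; left; apply/eqP; field.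
by rewrite gt_eqF.
Qed.

Lemma avg_sq_sing_cvg x k :
  avg (sq_sing x M) (fun s => s ^+ k) @[M --> \oo] --> moment theta x k.
Proof.
have [r xr] := radius_exists x.
apply/cvgrPdist_le => e e0.
set K := (l1normr x * l1normr x) ^+ k +
   complex.Re `|ttau (texp theta (tmul theta (tadj theta x) x) k)|.
have h : (1 - ((M.+1 - (r + r) * k - (r + r) * k) ^ n)%:R / (M.+1 ^ n)%:R) * K
    @[M --> \oo] --> ((1 - 1) * K : R).
  apply: cvgMr_tmp; apply: cvgB; first exact: cvg_cst.
  exact: interior_fraction.
rewrite subrr mul0r in h; have /cvgrPdist_le /(_ e e0) := h.
apply: filterS => M; rewrite sub0r normrN => hM.
apply: (le_trans (avg_sq_sing_close k M xr)); exact: le_trans (ler_norm _) hM.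
Qed.

End TraceLimit.

(** * Character averages and the norms *)

Section Multiplier.
Variable R : realType.
Local Notation C := R[i].
Local Notation "x %:C" := (real_complex R x) (format "x %:C").
Local Open Scope sesquilinear_scope.
Local Open Scope classical_set_scope.
Variables (n : nat) (n_gt0 : (0 < n)%N) (theta : 'M[R]_n).
Implicit Types (x y u : tpoly R n) (a b g d : 'rV[int]_n).

(** Realizability of the moments shows that [xget] does not return its default; whichever measure it
    selects, the integral is the limit of the averages. *)
Lemma Lpnorm_limit (p : R) x : 1 <= p -> exists v : R,
  (avg (sq_sing theta x M) (fun s => s `^ (p / 2)) @[M --> \oo] --> v) /\
  Lpnorm theta p x = v `^ p^-1.
Proof.
move=> p1; have p0 : 0 < p / 2 by rewrite divr_gt0 // (lt_le_trans ltr01).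
have S_gt0 M : (0 < size (sq_sing theta x M))%N.
  exact: leq_ltn_trans (leq0n M) (sq_sing_size_gt n_gt0 theta x M).
have bounds M s := @sq_sing_bounds R n theta x M s.
have cvgm k := @avg_sq_sing_cvg R n n_gt0 theta x k.
have [mu [mu0 muE]] := moments_realizable (sqr_ge0 _)
  (sq_sing_size_gt n_gt0 theta x) bounds cvgm.
have ex : exists r, is_Lpnorm theta p x r.
  by eexists; exists mu; split; [exists (l1normr x ^+ 2)|].
have [nu [[B [nu0 nuE]] normE]] := xgetPex 0 ex.
exists (fine (\int[nu]_(s in [set s | (0 <= s)%R]) (s `^ (p / 2))%:E)%E).
split; last exact: normE.
exact: (avg_powR_cvg p0 S_gt0 bounds cvgm nu0 nuE).
Qed.

(** The exponent is the signed sum of coordinates, which makes [chi z] a character of Z^n; it agrees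
    with [z ^ mdeg a] only for nonnegative multi-indices, and this is where holomorphy enters. *)
Definition chi (z : C) a : C := exprz z (\sum_j a ord0 j).

Lemma norm_chi z a : `|z| = 1 -> `|chi z a| = 1.
Proof.
move=> z1; rewrite /chi; case: (\sum_j _) => k; rewrite /exprz ?normfV normrX z1.
  exact: expr1n.
by rewrite expr1n invr1.
Qed.

Lemma chiB z g b : `|z| = 1 -> chi z (g - b) = chi z g * (chi z b)^*.
Proof.
move=> z1; have zN0 : z != 0 by rewrite -normr_eq0 z1 oner_neq0.
have -> : (chi z b)^* = (chi z b)^-1.
  by rewrite invC_norm norm_chi // expr1n invr1 mul1r.
rewrite /chi invr_expz -expfzDr //; congr (exprz z _).
by rewrite -sumrN -big_split; apply: eq_bigr => j _; rewrite !mxE.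
Qed.

Definition rnorm (z : C) : R := complex.Re `|z|.

Lemma rnormE z : (rnorm z)%:C = `|z|. Proof. exact: Re_norm. Qed.

Lemma rnorm_ge0 z : 0 <= rnorm z. Proof. by rewrite -ler0c rnormE normr_ge0. Qed.

Lemma rnormM z w : rnorm (z * w) = rnorm z * rnorm w.
Proof.
by apply: (@complexI R); rewrite -/(real_complex R _) rnormE normrM real_complexM !rnormE.
Qed.

Lemma rnorm_eq1 z : `|z| = 1 -> rnorm z = 1.
Proof. by move=> z1; rewrite /rnorm z1. Qed.

Lemma rnorm_sum (I : Type) (r : seq I) (F : I -> C) :
  rnorm (\sum_(i <- r) F i) <= \sum_(i <- r) rnorm (F i).
Proof.
rewrite -lecR rnormE real_complex_sum; apply: (le_trans (ler_norm_sum _ _ _)).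
by apply: ler_sum => i _; rewrite rnormE.
Qed.

(** Weighted Cauchy-Schwarz. The inductive step reduces to [2 t S <= T + A t^2], which follows from
    [(S - A t)^2 >= 0] and [S^2 <= A T]. *)
Lemma sum_sqr_le (I : Type) (r : seq I) (w v : I -> R) :
  (forall i, 0 <= w i) -> (\sum_(i <- r) w i * v i) ^+ 2 <=
  (\sum_(i <- r) w i) * \sum_(i <- r) w i * v i ^+ 2.
Proof.
move=> w0; elim: r => [|i r IHr]; first by rewrite !big_nil mul0r expr0n.
rewrite !big_cons; move: (w0 i) (v i) IHr.
have : 0 <= \sum_(j <- r) w j by exact: sumr_ge0.
have : 0 <= \sum_(j <- r) w j * v j ^+ 2.
  by apply: sumr_ge0 => j _; rewrite mulr_ge0 // sqr_ge0.
move: (\sum_(j <- r) w j) (\sum_(j <- r) w j * v j) (\sum_(j <- r) w j * v j ^+ 2).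
move=> A S T T0 A0 a0 t AT.
suff H : 2 * t * S <= T + A * t ^+ 2 by have := ler_wpM2l a0 H; nra.
have [A1|A1] := eqVneq A 0.
  have -> : S = 0 by apply/eqP; rewrite -sqrf_eq0 eq_le sqr_ge0 (le_trans AT) // A1 mul0r.
  by rewrite A1 mulr0 mul0r addr0.
have Ap : 0 < A by rewrite lt_neqAle eq_sym A1.
by rewrite -(ler_pM2l Ap); have := sqr_ge0 (S - A * t); nra.
Qed.

Definition l2sq u : R := complex.Re (ttau (tmul theta (tadj theta u) u)).

Lemma l2sqE (S : seq 'rV[int]_n) u : uniq S -> {subset keys u <= S} ->
  l2sq u = \sum_(d <- S) rnorm (coef u d) ^+ 2.
Proof.
move=> US uS; rewrite /l2sq -(lmx_diag theta _ 0) -(lmx_mul _ _ _ US); last first.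
  by move=> t tu; rewrite add0r; apply: uS; exact: map_f.
rewrite (eq_bigr (fun d => (rnorm (coef u d) ^+ 2)%:C)) -?real_complex_sum // => d _.
by rewrite lmx_adj lmx_coef real_complexX rnormE sqr_normc mulrC.
Qed.

Lemma coef_mul (S : seq 'rV[int]_n) x u g : uniq S -> {subset keys u <= S} ->
  coef (tmul theta x u) g = \sum_(d <- S) lmx theta x g d * coef u d.
Proof.
move=> US uS; rewrite -(lmx_coef theta) -(lmx_mul _ _ _ US).
  by apply: eq_bigr => d _; rewrite lmx_coef.
by move=> t tu; rewrite add0r; apply: uS; exact: map_f.
Qed.

Lemma l2sq_ge0 u : 0 <= l2sq u.
Proof.
rewrite (@l2sqE (undup (keys u))) ?undup_uniq // => [|d]; last by rewrite mem_undup.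
by apply: sumr_ge0 => d _; exact: sqr_ge0.
Qed.

(* Schur's test. *)
Lemma l2sq_mul_le x u : l2sq (tmul theta x u) <= l1normr x ^+ 2 * l2sq u.
Proof.
pose S := undup (keys u); pose S' := undup (keys (tmul theta x u)).
have US : uniq S by exact: undup_uniq.
have US' : uniq S' by exact: undup_uniq.
have uS : {subset keys u <= S} by move=> d; rewrite mem_undup.
rewrite (l2sqE US') => [|d]; last by rewrite mem_undup.
rewrite (l2sqE US uS).
have row g : \sum_(d <- S) rnorm (lmx theta x g d) <= l1normr x.
  rewrite -lecR real_complex_sum l1normrE; under eq_bigr do rewrite rnormE.
  exact: lmx_row_sum.
have col d : \sum_(g <- S') rnorm (lmx theta x g d) <= l1normr x.
  rewrite -lecR real_complex_sum l1normrE; under eq_bigr do rewrite rnormE.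
  exact: lmx_col_sum.
have l0 : 0 <= l1normr x by apply: le_trans (row 0); apply: sumr_ge0 => d _; exact: rnorm_ge0.
apply: (@le_trans _ _ (\sum_(g <- S') l1normr x *
    \sum_(d <- S) rnorm (lmx theta x g d) * rnorm (coef u d) ^+ 2)).
  apply: ler_sum => g _; rewrite (coef_mul _ _ US uS).
  apply: (@le_trans _ _ ((\sum_(d <- S) rnorm (lmx theta x g d) * rnorm (coef u d)) ^+ 2)).
    apply: lerXn2r; rewrite ?nnegrE ?rnorm_ge0 //.
      by apply: sumr_ge0 => d _; rewrite mulr_ge0 ?rnorm_ge0.
    by apply: (le_trans (rnorm_sum _ _)); apply: ler_sum => d _; rewrite rnormM.
  apply: (le_trans (sum_sqr_le _ _ (fun d => rnorm_ge0 _))).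
  apply: ler_wpM2r (row g); apply: sumr_ge0 => d _.
  by rewrite mulr_ge0 ?rnorm_ge0 ?sqr_ge0.
rewrite -mulr_sumr expr2 -mulrA; apply: ler_wpM2l => //.
rewrite exchange_big /= mulr_sumr; apply: ler_sum => d _.
by rewrite -mulr_suml ler_wpM2r // sqr_ge0.
Qed.

(** The adjoint of the diagonal unitary of [chi z], acting on vectors of L^2. *)
Definition twist (z : C) u : tpoly R n := [seq (t.1, (chi z t.1)^* * t.2) | t <- u].

Lemma coef_twist z u d : coef (twist z u) d = (chi z d)^* * coef u d.
Proof.
rewrite /coef big_map [RHS]mulr_sumr; apply: eq_bigr => t.
by move=> /eqP <-.
Qed.

Lemma keys_twist z u : keys (twist z u) = keys u.
Proof. by rewrite /keys -map_comp. Qed.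

Lemma l2sq_twist z u : `|z| = 1 -> l2sq (twist z u) = l2sq u.
Proof.
move=> z1; pose S := undup (keys u); have US : uniq S by exact: undup_uniq.
have uS : {subset keys u <= S} by move=> d; rewrite mem_undup.
rewrite !(@l2sqE S) ?keys_twist //; apply: eq_bigr => d _.
by rewrite coef_twist rnormM rnorm_eq1 ?mul1r // norm_conjC norm_chi.
Qed.

Lemma keys_mul x u : keys (tmul theta x u) = [seq a + b | a <- keys x, b <- keys u].
Proof. by rewrite /keys /tmul map_allpairs allpairs_mapl allpairs_mapr. Qed.

Definition opnorm_set u : set R := [set r : R | exists xi : tpoly R n,
  l2sq xi <= 1 /\ r = Num.sqrt (l2sq (tmul theta u xi))].

Lemma opnormE u : opnorm theta u = sup (opnorm_set u).
Proof. by []. Qed.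

Lemma opnorm_set_ubound u : has_ubound (opnorm_set u).
Proof.
exists (Num.sqrt (l1normr u ^+ 2)) => r [xi [xi1 ->]].
apply: ler_wsqrtr; apply: (le_trans (l2sq_mul_le _ _)).
by rewrite ler_piMr // sqr_ge0.
Qed.

Lemma l2sq_mul_opnorm u xi : l2sq xi <= 1 ->
  l2sq (tmul theta u xi) <= opnorm theta u ^+ 2.
Proof.
move=> xi1; have h : Num.sqrt (l2sq (tmul theta u xi)) <= opnorm theta u.
  by rewrite opnormE; apply: ub_le_sup; [exact: opnorm_set_ubound|exists xi].
rewrite -(sqr_sqrtr (l2sq_ge0 (tmul theta u xi))) lerXn2r ?nnegrE ?sqrtr_ge0 //.
exact: le_trans (sqrtr_ge0 _) h.
Qed.

Lemma opnorm_ge0 u : 0 <= opnorm theta u.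
Proof.
have z1 : l2sq [::] <= 1 by rewrite (@l2sqE [::]) // big_nil ler01.
rewrite opnormE; apply: (@le_trans _ _ (Num.sqrt (l2sq (tmul theta u [::])))).
  exact: sqrtr_ge0.
by apply: ub_le_sup; [exact: opnorm_set_ubound|exists [::]].
Qed.

Section CharacterSum.
Variables (s : seq (C * C)) (c : R) (x y : tpoly R n).
Hypothesis (s1 : forall t, t \in s -> `|t.2| = 1).
Hypothesis (c_gt0 : 0 < c) (sc : \sum_(t <- s) `|t.1| = c%:C).
Hypothesis (xy : forall a, coef y a = \sum_(t <- s) t.1 * chi t.2 a * coef x a).

(** Since [chi (g - b)] splits, multiplying coefficients by a character is conjugation of the matrix
    by a diagonal unitary. *)
Lemma lmx_chi g b : lmx theta y g b =
  \sum_(t <- s) t.1 * (chi t.2 g * (chi t.2 b)^* * lmx theta x g b).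
Proof.
rewrite /lmx xy mulr_suml big_seq [RHS]big_seq; apply: eq_bigr => t ts.
by rewrite chiB ?s1 // !mulrA.
Qed.

Lemma trunc_mx_chi m : trunc_mx theta m y =
  \sum_(t <- [seq (t.1, \row_i chi t.2 (box_pt i)) | t <- s])
    t.1 *: (diag_mx t.2 *m trunc_mx theta m x *m (diag_mx t.2)^t*).
Proof.
rewrite big_map; apply/matrixP => a b; rewrite mxE lmx_chi summxE.
apply: eq_bigr => t _; rewrite mxE /=; congr (_ * _).
rewrite tr_diag_mx map_diag_mx mul_mx_diag mul_diag_mx !mxE.
by rewrite mulrAC.
Qed.

Lemma Lpnorm_chi p : 1 <= p -> Lpnorm theta p y <= c * Lpnorm theta p x.
Proof.
move=> p1; have p0 : 0 < p by rewrite (lt_le_trans ltr01).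
have [v [cv ->]] := Lpnorm_limit x p1; have [w [cw ->]] := Lpnorm_limit y p1.
have avg0 u M : 0 <= avg (sq_sing theta u M) (fun s => s `^ (p / 2)).
  by rewrite divr_ge0 // sumr_ge0 // => r _; rewrite powR_ge0.
have v0 : 0 <= v by apply: (ler_cvg_to (cvg_cst 0) cv); exact: nearW.
have w0 : 0 <= w by apply: (ler_cvg_to (cvg_cst 0) cw); exact: nearW.
have wv : w <= c `^ p * v.
  have ccv : c `^ p * avg (sq_sing theta x M) (fun r => r `^ (p / 2))
      @[M --> \oo] --> (c `^ p * v : R) by exact: cvgMl_tmp.
  apply: (ler_cvg_to cw ccv); apply: nearW => M.
  have sumE u : \sum_(r <- sq_sing theta u M) r `^ (p / 2) =
      \sum_i (dil_eig (trunc_mx theta M.+1 u) i ^+ 2) `^ (p / 2).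
    by rewrite big_map big_enum.
  rewrite /avg !size_sq_sing !sumE mulrA.
  rewrite ler_wpM2r ?invr_ge0 //.
  apply: (dil_eig_powR_le p1 c_gt0 _ _ (trunc_mx_chi M.+1)).
    by move=> t /mapP[r rs ->] i; rewrite mxE norm_chi // s1.
  by rewrite big_map.
have pV0 : 0 <= p^-1 by rewrite invr_ge0 ltW.
apply: (@le_trans _ _ ((c `^ p * v) `^ p^-1)).
  by apply: ge0_ler_powR; rewrite ?nnegrE // mulr_ge0 ?powR_ge0.
rewrite powRM ?powR_ge0 // -powRrM divff ?gt_eqF // powRr1 // ltW //.
Qed.

(** The triangle inequality in squared form: Cauchy-Schwarz with weights [|t.1|] of total mass [c]
    gives one factor [c], and summation over [s] gives the other. The left diagonal unitaries
    preserve moduli of coefficients; the right ones are the twists of [xi]. *)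
Lemma l2sq_chi_le xi (K : R) :
  (forall t, t \in s -> l2sq (tmul theta x (twist t.2 xi)) <= K) ->
  l2sq (tmul theta y xi) <= c ^+ 2 * K.
Proof.
move=> xK; pose S := undup (keys xi); have US : uniq S by exact: undup_uniq.
have xiS : {subset keys xi <= S} by move=> d; rewrite mem_undup.
pose S' := undup (keys (tmul theta x xi) ++ keys (tmul theta y xi)).
have US' : uniq S' by exact: undup_uniq.
have yS' : {subset keys (tmul theta y xi) <= S'}.
  by move=> d dy; rewrite mem_undup mem_cat dy orbT.
have xS' z : {subset keys (tmul theta x (twist z xi)) <= S'}.
  by move=> d; rewrite keys_mul keys_twist -keys_mul mem_undup mem_cat => ->.
have coefE g : coef (tmul theta y xi) g =
    \sum_(t <- s) t.1 * chi t.2 g * coef (tmul theta x (twist t.2 xi)) g.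
  rewrite (coef_mul _ _ US xiS).
  under eq_bigr do rewrite lmx_chi mulr_suml.
  rewrite exchange_big /=; apply: eq_bigr => t _.
  rewrite (@coef_mul S) ?keys_twist // mulr_sumr; apply: eq_bigr => d _.
  by rewrite coef_twist; ring.
have scr : \sum_(t <- s) rnorm t.1 = c.
  apply: (@complexI R); rewrite -/(real_complex R _) real_complex_sum -[RHS]sc.
  by apply: eq_bigr => t _; exact: rnormE.
rewrite (l2sqE US' yS').
apply: (@le_trans _ _ (\sum_(g <- S') c * \sum_(t <- s)
    rnorm t.1 * rnorm (coef (tmul theta x (twist t.2 xi)) g) ^+ 2)).
  apply: ler_sum => g _; rewrite coefE -scr.
  apply: le_trans (sum_sqr_le _ _ (fun t => rnorm_ge0 _)).
  apply: lerXn2r; rewrite ?nnegrE ?rnorm_ge0 //.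
    by apply: sumr_ge0 => t _; rewrite mulr_ge0 ?rnorm_ge0.
  apply: (le_trans (rnorm_sum _ _)); rewrite big_seq [leRHS]big_seq.
  apply: ler_sum => t ts; rewrite !rnormM (rnorm_eq1 (norm_chi _ (s1 ts))) mulr1.
  exact: lexx.
rewrite -mulr_sumr expr2 -mulrA; apply: ler_wpM2l; first exact: ltW.
rewrite exchange_big /= -scr mulr_suml big_seq [leRHS]big_seq.
apply: ler_sum => t ts; rewrite -mulr_sumr; apply: ler_wpM2l; first exact: rnorm_ge0.
by rewrite -(l2sqE US' (xS' t.2)); exact: xK.
Qed.

Lemma opnorm_chi : opnorm theta y <= c * opnorm theta x.
Proof.
rewrite opnormE; apply: ge_sup.
  exists (Num.sqrt (l2sq (tmul theta y [::]))), [::]; split=> //.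
  by rewrite (@l2sqE [::]) // big_nil ler01.
move=> r [xi [xi1 ->]].
have cx0 : 0 <= c * opnorm theta x by rewrite mulr_ge0 ?opnorm_ge0 // ltW.
rewrite -(ger0_norm cx0) -sqrtr_sqr; apply: ler_wsqrtr; rewrite exprMn.
apply: l2sq_chi_le => t ts; apply: l2sq_mul_opnorm.
by rewrite l2sq_twist // s1.
Qed.

Lemma qnorm_chi (p : \bar R) : (1 <= p)%E -> qnorm theta p y <= c * qnorm theta p x.
Proof.
case: p => [p| |] /=; rewrite ?lee_fin => p1.
- exact: Lpnorm_chi.
- exact: opnorm_chi.
- by rewrite mulr0.
Qed.

End CharacterSum.

Lemma mdeg_holomorphic x a (z : C) : holomorphic x -> coef x a != 0 ->
  chi z a = z ^+ mdeg a.
Proof.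
move=> hx xa; rewrite /chi exprnP; congr (exprz z _).
rewrite /mdeg (big_morph Posz PoszD (erefl _)); apply: eq_bigr => j _.
by rewrite gez0_abs // (hx _ xa).
Qed.

(** The relation between [x] and [y] is by coefficients only, so it also applies with [Lgen x] or
    [Pt t x] as source and [x] as target. *)
Lemma qnorm_multiplier (P : pred nat) (m : nat -> R) (c : R) x y (p : \bar R) :
  (1 <= p)%E -> 0 < c -> circle_moments P m c -> holomorphic x ->
  (forall a, coef x a != 0 -> P (mdeg a)) ->
  (forall a, coef y a = (m (mdeg a))%:C * coef x a) ->
  qnorm theta p y <= c * qnorm theta p x.
Proof.
move=> p1 c0 [s [s1 sc sm]] hx xP xy; apply: (qnorm_chi s1 c0 sc) => // a.
rewrite xy; have [->|xa] := eqVneq (coef x a) 0.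
  by rewrite mulr0 big1 // => t _; rewrite mulr0.
rewrite -mulr_suml sm ?xP //; congr (_ * _).
by apply: eq_bigr => t _; rewrite (mdeg_holomorphic _ hx xa).
Qed.

End Multiplier.

(** * Proof of the theorem *)

Section PoissonWeights.
Variable R : realType.

Lemma expR_convex_seq (t : R) (j : nat) : 0 <= t ->
  [/\ 0 <= expR (- t * j%:R), expR (- t * j.+1%:R) <= expR (- t * j%:R) &
   2 * expR (- t * j.+1%:R) <= expR (- t * j%:R) + expR (- t * j.+2%:R)].
Proof.
move=> t0; have q0 := expR_gt0 (- t); have q1 : expR (- t) <= 1.
  by rewrite -[leRHS]expR0 ler_expR oppr_le0.
have E k : expR (- t * k%:R) = expR (- t) ^+ k by exact: expRM_natr.
have := exprn_ge0 j (ltW q0); rewrite !E !exprS; move: (expR _ ^+ j) => r r0.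
split=> //; first nra.
by have := sqr_ge0 (1 - expR (- t)); nra.
Qed.

Lemma inv_convex_seq (d j : nat) : (0 < d)%N ->
  [/\ 0 <= (d + j)%:R^-1 :> R, (d + j.+1)%:R^-1 <= (d + j)%:R^-1 :> R &
   2 * (d + j.+1)%:R^-1 <= (d + j)%:R^-1 + (d + j.+2)%:R^-1 :> R].
Proof.
move=> d0; have u0 : 0 < (d + j)%:R :> R by rewrite ltr0n addn_gt0 d0.
rewrite !addnS -[(d + j).+2%:R]natr1 -[(d + j).+1%:R]natr1.
move: ((d + j)%:R : R) u0 => u u0; split.
- by rewrite invr_ge0 ltW.
- by rewrite lef_pV2 ?posrE ?lerDl // addr_gt0.
- rewrite -subr_ge0.
  have -> : u^-1 + (u + 1 + 1)^-1 - 2 * (u + 1)^-1 =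
      2 / (u * (u + 1) * (u + 1 + 1)).
    by field; rewrite !gt_eqF // !addr_gt0.
  by rewrite divr_ge0 // !mulr_ge0 // ?ltW // !addr_gt0.
Qed.

Lemma trunc_convex_seq (d j : nat) :
  [/\ 0 <= (d - j)%:R :> R, (d - j.+1)%:R <= (d - j)%:R :> R &
   2 * (d - j.+1)%:R <= (d - j)%:R + (d - j.+2)%:R :> R].
Proof.
split; first exact: ler0n.
- by rewrite ler_nat; lia.
- by rewrite -natrM -natrD ler_nat; lia.
Qed.

End PoissonWeights.

Section Coefficients.
Variables (R : realType) (n : nat).
Implicit Types (x : tpoly R n) (a : 'rV[int]_n).
Local Notation "x %:C" := (real_complex R x) (format "x %:C").

Lemma coef_Pt (t : R) x a :
  coef (Pt t x) a = (expR (- t * (mdeg a)%:R))%:C * coef x a.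
Proof.
rewrite /coef /Pt big_map [RHS]mulr_sumr; apply: eq_bigr => u.
by move=> /eqP <-.
Qed.

Lemma coef_Lgen x a : coef (Lgen x) a = ((mdeg a)%:R : R)%:C * coef x a.
Proof.
rewrite /coef /Lgen big_map [RHS]mulr_sumr; apply: eq_bigr => u.
by move=> /eqP <-.
Qed.

(** Supplies the finite range of degrees on which a multiplier must be represented when degrees are
    only bounded below. *)
Lemma coef_degree_bound x : exists K, forall a, coef x a != 0 -> (mdeg a <= K)%N.
Proof.
exists (\max_(t <- x) mdeg t.1) => a xa.
have [t tx ->] : exists2 t, t \in x & a = t.1.
  apply/mapP; apply: contraNT xa => ax; rewrite /coef big_seq_cond big1 // => t.
  by move=> /andP[tx /eqP ta]; case/negP: ax; rewrite -ta map_f.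
by apply: (leq_bigmax_seq (F := fun t : 'rV[int]_n * R[i] => mdeg t.1)) tx _.
Qed.

Lemma holomorphic_scale x y (m : nat -> R) : holomorphic x ->
  (forall a, coef y a = (m (mdeg a))%:C * coef x a) -> holomorphic y.
Proof.
move=> hx xy a ya; apply: hx; apply: contraNneq ya => xa.
by rewrite xy xa mulr0.
Qed.

End Coefficients.

Theorem theorem1p8 (R : realType) (n : nat) (hn : (1 <= n)%N)
    (theta : 'M[R]_n) (hskew : theta^T = - theta)
    (p : \bar R) (hp : (1 <= p)%E) (d : nat) (hd : (1 <= d)%N)
    (x : tpoly R n) (hx : holomorphic x) :
  (in_Pge d x ->
     (forall t : R, 0 <= t ->
        qnorm theta p (Pt t x) <= expR (- t * d%:R) * qnorm theta p x) /\
     qnorm theta p (Lgen x) >= d%:R * qnorm theta p x) /\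
  (in_Ple d x ->
     qnorm theta p (Lgen x) <= d%:R * qnorm theta p x /\
     (forall t : R, 0 <= t ->
        qnorm theta p (Pt t x) >= expR (- t * d%:R) * qnorm theta p x)).
Proof.
have d0 : 0 < d%:R :> R by rewrite ltr0n.
have [K xK] := coef_degree_bound x.
have convex (a : nat -> R) k :
    (forall j, [/\ 0 <= a j, a j.+1 <= a j & 2 * a j.+1 <= a j + a j.+2]) ->
    posdef_on k a.
  by move=> aP; apply: posdef_on_convex => j; case: (aP j).
split=> xd; split.
(* At degree [k = d + j] this is [e^{-tk}], with mass [a 0 = e^{-td}]. *)
- move=> t t0; pose a j := expR (- t * d%:R) * expR (- t * j%:R).
  have aP : posdef_on K a.
    apply: posdef_onZ; first exact: expR_ge0.
    by apply: convex => j; exact: expR_convex_seq.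
  have := circle_moments_ge d aP; rewrite {2}/a mulr0 expR0 mulr1 => tm.
  apply: (qnorm_multiplier hn theta hp (expR_gt0 _) tm hx) => b.
    by move=> xb; rewrite xd ?xK.
  rewrite coef_Pt; have [->|xb] := eqVneq (coef x b) 0; first by rewrite !mulr0.
  congr (real_complex R _ * _); rewrite /a -expRD -mulrDr -natrD.
  by rewrite subnKC // xd.
(* The inverse of the generator on degrees [k >= d], with mass [1/d], applied to [Lgen x]. *)
- pose a j : R := (d + j)%:R^-1.
  have aP : posdef_on K a by apply: convex => j; exact: inv_convex_seq.
  have := circle_moments_ge d aP; rewrite {2}/a addn0 => tm.
  have Lx b : coef (Lgen x) b != 0 -> coef x b != 0.
    by apply: contraNneq => xb; rewrite coef_Lgen xb mulr0.
  have hL := holomorphic_scale hx (coef_Lgen x).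
  rewrite -ler_pdivlMl //; apply: (qnorm_multiplier hn theta hp _ tm hL) => [|b|b].
  + by rewrite invr_gt0.
  + by move=> /Lx xb; rewrite xd ?xK.
  have [xb0|xb] := eqVneq (coef x b) 0; first by rewrite coef_Lgen xb0 !mulr0.
  rewrite coef_Lgen mulrA -real_complexM /a subnKC ?xd // mulVf ?mul1r //.
  by rewrite pnatr_eq0 -lt0n (leq_trans hd) // xd.
(* Truncated subtraction is the convex function [(d - j)_+]; at [j = d - k] it equals [k], and the
   mass is [d]. *)
- pose a j : R := (d - j)%:R.
  have aP : posdef_on d a by apply: convex => j; exact: trunc_convex_seq.
  have := circle_moments_le aP; rewrite {2}/a subn0 => tm.
  apply: (qnorm_multiplier hn theta hp d0 tm hx) => b; first exact: xd.
  have [xb0|xb] := eqVneq (coef x b) 0; first by rewrite coef_Lgen xb0 !mulr0.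
  by rewrite coef_Lgen /a subKn // xd.
(* The inverse of the semigroup: at [j = d - k] this is [e^{tk}], with mass [e^{td}], applied to
   [Pt t x]. *)
- move=> t t0; pose a j := expR (t * d%:R) * expR (- t * j%:R).
  have aP : posdef_on d a.
    apply: posdef_onZ; first exact: expR_ge0.
    by apply: convex => j; exact: expR_convex_seq.
  have := circle_moments_le aP; rewrite {2}/a mulr0 expR0 mulr1 => tm.
  have Px b : coef (Pt t x) b != 0 -> coef x b != 0.
    by apply: contraNneq => xb; rewrite coef_Pt xb mulr0.
  have hP := @holomorphic_scale _ _ _ _ (fun k => expR (- t * k%:R)) hx (coef_Pt t x).
  rewrite mulNr expRN -ler_pdivlMl ?invr_gt0 ?expR_gt0 // invrK.
  apply: (qnorm_multiplier hn theta hp (expR_gt0 _) tm hP) => b.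
    by move=> /Px; exact: xd.
  have [xb0|xb] := eqVneq (coef x b) 0; first by rewrite coef_Pt xb0 !mulr0.
  rewrite coef_Pt mulrA -real_complexM /a -!expRD natrB ?xd //.
  rewrite [X in expR X](_ : _ = 0) ?expR0 ?mul1r //; ring.
Qed.
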